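(* Let $(\Omega_{a,\epsilon})$, $a\in(0,1)$, $0<\epsilon<\epsilon_0(a)$, be a family of planar domains satisfying the standing assumptions (F) and (P1)--(P6) listed in the context, let $u_{a,\epsilon}$ be the solution of $-\Delta u=1$ in $\Omega_{a,\epsilon}$, $u=0$ on $\partial\Omega_{a,\epsilon}$, and let $b^*\in(0,1)$ be the critical parameter defined in the context. Fix $a\in(0,b^* )$. Then there exists $\epsilon^*(a)\in(0,\epsilon_0(a)]$ such that, for all $\epsilon\in(0,\epsilon^*(a))$, the domain $\Omega_{a,\epsilon}$ is smooth, symmetric with respect to both coordinate axes, star-shaped with respect to the origin, and convex in the $x$-direction, whereas the superlevel set \[ \mathcal L_{a,\epsilon}:=\bigl\{(x,y)\in\Omega_{a,\epsilon}: u_{a,\epsilon}(x,y)>u_{a,\epsilon}(0,0)\bigr\} \] is not star-shaped. In fact, $\mathcal L_{a,\epsilon}$ is disconnected.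
   Context: $B=B_1(0)\subset\mathbb R^2$ is the open unit disk. For $a\in(0,1)$ put $S_a=\bigl((-1,-a]\cup[a,1)\bigr)\times\{0\}$, $\overline{S_a}=\bigl([-1,-a]\cup[a,1]\bigr)\times\{0\}$ and $D_a=B\setminus S_a$. Let $u_a\in H_0^1(D_a)$ be the weak solution of $-\Delta u=1$ in $D_a$, $\mu(a):=\partial_{yy}u_a(0)$, and $b^*:=\inf\{a\in(0,1):\mu(a)\le0\}$, which lies in $(0,1)$. Standing assumptions on the family. For every $a\in(0,1)$ there is $\epsilon_0(a)>0$ such that, for all $0<\epsilon<\epsilon_0(a)$: (F) $\Omega_{a,\epsilon}=\{(x,y): |y|<1,\ -\rho_{a,\epsilon}(y)<x<\rho_{a,\epsilon}(y)\}$, where $\rho_{a,\epsilon}\in C^\infty((-1,1))\cap C([-1,1])$ is even, $0<\rho_{a,\epsilon}(y)\le\sqrt{1-y^2}$ for $|y|<1$, and $\rho_{a,\epsilon}(\pm1)=0$. The removed open slot is $T_{a,\epsilon}=\{(x,y)\in B: |x|>\rho_{a,\epsilon}(y)\}$, so that $\Omega_{a,\epsilon}=B\setminus\overline{T_{a,\epsilon}}$. (P1) $\Omega_{a,\epsilon}$ is a bounded, $C^\infty$, simply connected, nonconvex planar domain, symmetric with respect to both coordinate axes. (P2) $\Omega_{a,\epsilon}\subset D_a$. (P3) $\overline{T_{a,\epsilon}}\to\overline{S_a}$ in Hausdorff distance as $\epsilon\to0$. (P4) $\Omega_{a,\epsilon_2}\subset\Omega_{a,\epsilon_1}$ whenever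 $0<\epsilon_1<\epsilon_2<\epsilon_0(a)$, and $\bigcup_{0<\epsilon<\epsilon_0(a)}\Omega_{a,\epsilon}=D_a$. (P5) $\Omega_{a,\epsilon}$ is star-shaped with respect to the origin: $t\Omega_{a,\epsilon}\subset\Omega_{a,\epsilon}$ for all $t\in[0,1]$. (P6) $\Omega_{a,\epsilon}$ is convex in the $x$-direction: for each $y\in(-1,1)$ the set $\{x:(x,y)\in\Omega_{a,\epsilon}\}$ is convex. *)

(* Defs.v *)
From HB Require Import structures.
From mathcomp Require Import all_boot all_order all_algebra.
From mathcomp Require Import all_classical all_reals all_analysis.

Set Implicit Arguments.
Unset Strict Implicit.
Unset Printing Implicit Defensive.

Import Order.TTheory GRing.Theory Num.Theory.
Import numFieldNormedType.Exports.

Local Open Scope classical_set_scope.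
Local Open Scope ring_scope.

(* A point of the plane is a pair p, with coordinates p.1 (x) and p.2 (y).
   The topology of R * R is the product one, i.e. the Euclidean topology; the
   library's norm on R * R is the sup norm, so wherever a metric notion is
   meant (the disk, Hausdorff distance) the Euclidean norm enorm is used. *)

Section Plane.
Context {R : realType}.

Definition enorm (p : R * R) : R := Num.sqrt (p.1 ^+ 2 + p.2 ^+ 2).

Definition disk : set (R * R) := [set p | enorm p < 1].

(* The derivatives below are the library's total operators: they carry
   information only where the corresponding derivable hypothesis holds. *)
Definition dx (f : R * R -> R) (p : R * R) : R := derive1 (fun t : R => f (t, p.2)) p.1.
Definition dy (f : R * R -> R) (p : R * R) : R := derive1 (fun t : R => f (p.1, t)) p.2.

Definition laplacian (f : R * R -> R) (p : R * R) : R :=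
  dx (dx f) p + dy (dy f) p.

(* f is of class C^k on U; meant for open U. *)
Fixpoint Ck_on (k : nat) (U : set (R * R)) (f : R * R -> R) : Prop :=
  (forall p, U p -> {for p, continuous f}) /\
  if k is k'.+1 then
    [/\ forall p, U p -> derivable (fun t : R => f (t, p.2)) p.1 1,
        forall p, U p -> derivable (fun t : R => f (p.1, t)) p.2 1,
        Ck_on k' U (dx f) & Ck_on k' U (dy f)]
  else True.

Definition smooth_on (U : set (R * R)) (f : R * R -> R) : Prop :=
  forall k, Ck_on k U f.

(* C^infty on I; meant for open I. *)
Definition smooth1_on (I : set R) (h : R -> R) : Prop :=
  forall (k : nat) (t : R), I t -> derivable (derive1n k h) t 1.

(* The boundary of A is C^infty: near each of its points, up to exchanging and
   reflecting the coordinate axes, A is the strict subgraph of a C^infty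
   function. *)
Definition smooth_boundary (A : set (R * R)) : Prop :=
  forall p, (closure A `\` A°) p ->
  exists (r : R) (h : R -> R), [/\ 0 < r, smooth1_on setT h &
    let N := [set q | enorm (q - p) < r] in
    [\/ A `&` N = [set q | q.2 < h q.1] `&` N,
        A `&` N = [set q | h q.1 < q.2] `&` N,
        A `&` N = [set q | q.1 < h q.2] `&` N |
        A `&` N = [set q | h q.2 < q.1] `&` N]].

Definition domain (A : set (R * R)) : Prop :=
  [/\ open A, A !=set0 & connected A].

Definition simply_connected (A : set (R * R)) : Prop :=
  (forall p q, A p -> A q -> exists c : R -> R * R,
     [/\ {within `[0, 1]%classic, continuous c}, c @` `[0, 1]%classic `<=` A,
         c 0 = p & c 1 = q]) /\
  (forall c : R -> R * R,
     {within `[0, 1]%classic, continuous c} -> c @` `[0, 1]%classic `<=` A -> c 0 = c 1 ->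
     exists H : R * R -> R * R,
     [/\ {within `[0, 1]%classic `*` `[0, 1]%classic, continuous H},
         H @` (`[0, 1]%classic `*` `[0, 1]%classic) `<=` A,
         forall t, 0 <= t <= 1 -> H (0, t) = c t,
         forall t, 0 <= t <= 1 -> H (1, t) = c 0 &
         forall s, 0 <= s <= 1 -> H (s, 0) = c 0 /\ H (s, 1) = c 0]).

Definition convex_plane_set (A : set (R * R)) : Prop :=
  @convex_set R (R^o * R^o)%type A.

Definition axes_symmetric (A : set (R * R)) : Prop :=
  forall x y, A (x, y) -> A (- x, y) /\ A (x, - y).

(* A need not contain p here; this matters only for A empty. *)
Definition star_shaped_wrt (p : R * R) (A : set (R * R)) : Prop :=
  forall q t, A q -> 0 <= t <= 1 ->
    A (p.1 + t * (q.1 - p.1), p.2 + t * (q.2 - p.2)).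

Definition star_shaped (A : set (R * R)) : Prop :=
  exists2 p, A p & star_shaped_wrt p A.

Definition x_convex (A : set (R * R)) : Prop :=
  forall y, -1 < y < 1 -> @convex_set R R^o [set x | A (x, y)].

Definition dist_to (p : R * R) (A : set (R * R)) : \bar R :=
  ereal_inf [set (enorm (p - q))%:E | q in A].

Definition hausdorff_distance (A B : set (R * R)) : \bar R :=
  maxe (ereal_sup [set dist_to p B | p in A])
       (ereal_sup [set dist_to p A | p in B]).

(* measurableTypeR R is convertible to R: plane is R * R with its Borel sets. *)
Definition plane : measurableType _ :=
  (measurableTypeR R * measurableTypeR R)%type.

Definition leb2 : {measure set plane -> \bar R} :=
  (@lebesgue_measure R \x @lebesgue_measure R)%E.

Definition L2_sq (D : set (R * R)) (f : R * R -> R) : \bar R :=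
  (\int[leb2]_(p in (D : set plane)) ((f p) ^+ 2)%:E)%E.

Definition in_L2 (D : set (R * R)) (f : R * R -> R) : Prop :=
  measurable_fun (D : set plane) (f : plane -> R) /\ (L2_sq D f < +oo)%E.

Definition test_function (D : set (R * R)) (phi : R * R -> R) : Prop :=
  smooth_on setT phi /\
  exists K : set (R * R), [/\ compact K, K `<=` D &
                              forall p, ~ K p -> phi p = 0].

(* u belongs to H^1_0(D), the closure of the test functions in the H^1 norm,
   and its weak gradient is (g1, g2). *)
Definition H10_with_gradient (D : set (R * R)) (u g1 g2 : R * R -> R) : Prop :=
  [/\ in_L2 D u, in_L2 D g1, in_L2 D g2 &
   exists phi : nat -> R * R -> R,
   [/\ forall n, test_function D (phi n),
       L2_sq D (fun p => phi n p - u p) @[n --> \oo] --> 0%E,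
       L2_sq D (fun p => dx (phi n) p - g1 p) @[n --> \oo] --> 0%E &
       L2_sq D (fun p => dy (phi n) p - g2 p) @[n --> \oo] --> 0%E]].

(* u is the weak solution in H^1_0(D) of - Laplacian u = 1. Elements of
   H^1_0(D) are classes modulo null sets; as point values and derivatives of u
   are needed, u is its (unique) representative that is continuous on D. *)
Definition weak_solution (D : set (R * R)) (u : R * R -> R) : Prop :=
  (forall p, D p -> {for p, continuous u}) /\
  exists g1 g2, H10_with_gradient D u g1 g2 /\
    forall psi, test_function D psi ->
      (\int[leb2]_(p in (D : set plane)) (g1 p * dx psi p + g2 p * dy psi p)%:E =
       \int[leb2]_(p in (D : set plane)) (psi p)%:E)%E.

Definition classical_solution (A : set (R * R)) (u : R * R -> R) : Prop :=
  [/\ Ck_on 2 A u, {within closure A, continuous u},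
      forall p, A p -> - laplacian u p = 1 &
      forall p, (closure A `\` A°) p -> u p = 0].

Definition slits (a : R) : set (R * R) :=
  [set p | (-1 < p.1 <= - a \/ a <= p.1 < 1) /\ p.2 = 0].

Definition closed_slits (a : R) : set (R * R) :=
  [set p | (-1 <= p.1 <= - a \/ a <= p.1 <= 1) /\ p.2 = 0].

Definition slit_disk (a : R) : set (R * R) := disk `\` slits a.

Definition mu (u : R -> R * R -> R) (a : R) : R := dy (dy (u a)) (0, 0).

Definition bstar (u : R -> R * R -> R) : R :=
  inf [set a | 0 < a < 1 /\ mu u a <= 0].

Definition slot (rho : R -> R) : set (R * R) :=
  [set p | disk p /\ rho p.2 < `|p.1|].

Definition profile_domain (rho : R -> R) (A : set (R * R)) : Prop :=
  [/\ A = [set p | `|p.2| < 1 /\ - rho p.2 < p.1 < rho p.2],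
      smooth1_on [set y | -1 < y < 1] rho /\ {within `[-1, 1]%classic, continuous rho},
      (forall y, -1 <= y <= 1 -> rho (- y) = rho y) /\ rho 1 = 0 /\ rho (-1) = 0,
      forall y, `|y| < 1 -> 0 < rho y <= Num.sqrt (1 - y ^+ 2) &
      A = disk `\` closure (slot rho)].

Definition smooth_symmetric_nonconvex_domain (A : set (R * R)) : Prop :=
  [/\ domain A /\ bounded_set A, smooth_boundary A, simply_connected A,
      ~ convex_plane_set A & axes_symmetric A].

Definition standing_assumptions (eps0 : R -> R) (rho : R -> R -> R -> R)
    (Omega : R -> R -> set (R * R)) : Prop :=
  forall a, 0 < a < 1 ->
  0 < eps0 a /\
  (forall e, 0 < e < eps0 a ->
     [/\ profile_domain (rho a e) (Omega a e),
         smooth_symmetric_nonconvex_domain (Omega a e),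
         Omega a e `<=` slit_disk a,
         star_shaped_wrt (0, 0) (Omega a e) &
         x_convex (Omega a e)]) /\
  hausdorff_distance (closure (slot (rho a e))) (closed_slits a)
    @[e --> 0^'+] --> 0%E /\
  (forall e1 e2, 0 < e1 -> e1 < e2 -> e2 < eps0 a -> Omega a e2 `<=` Omega a e1) /\
  \bigcup_(e in [set e | 0 < e < eps0 a]) Omega a e = slit_disk a.

Definition superlevel (A : set (R * R)) (u : R * R -> R) : set (R * R) :=
  [set p | A p /\ u (0, 0) < u p].

End Plane.

(* Main.v *)
Require Import Defs.
From mathcomp Require Import all_boot all_order all_algebra.
From mathcomp Require Import all_classical all_reals all_analysis.
From mathcomp Require Import measurable_realfun ring lra.
Import Order.TTheory GRing.Theory Num.Theory.
Import numFieldNormedType.Exports.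
Local Open Scope classical_set_scope.
Local Open Scope ring_scope.

(** Why the theorem holds. The superlevel set [L] lies above the value of the
    solution at the origin. On the horizontal axis the solution [v] of the
    approximating domain is maximal at the origin: its mirror image across a
    vertical line [x = l], [l >= 0], minus [v] is harmonic to the right of the
    line and nonnegative on the boundary there, because the domain is symmetric
    and convex in the x-direction ([axis_max]). Hence [L] misses the axis
    [y = 0]. On the other hand [a < b^*] gives [mu(a) > 0], so the limit
    solution [u_a] exceeds [u_a(0,0)] at some point [(0,y)] close to the origin
    ([convex_at0_not_max]); if the solutions converge to [u_a] at the two points
    [(0,0)] and [(0,y)], then [L] contains [(0,y)] for small parameters, and by
    symmetry [(0,-y)]. A set that meets both open half-planes but not the axis
    between them is neither connected nor star-shaped.

    The work is the pointwise convergence ([solutions_converge]). The weak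
    solution is a limit in H^1 of test functions [phi_n]; the support of [phi_n]
    is compact, hence contained in the approximating domains with a small
    parameter. For such a domain, with solution [v] extended by zero, the
    difference [v - phi_n] is continuous and vanishes off the domain, so a C^1
    truncation [w] of it has compact support in the domain. Testing the
    classical equation of [v] and the weak equation of [u_a] with [w], and
    subtracting, gives

      [int |grad w|^2 <= int |grad phi_n - g|^2],

    where [g] is the weak gradient of [u_a]; with Poincare's inequality [w] is
    small in L^2 ([truncated_energy_estimate]), and therefore so is [v - u_a],
    up to the truncation error. Finally [v] is equicontinuous: differences of
    [v] and its mirror images are harmonic and are controlled by an explicit
    harmonic barrier ([torsion_osc]). Closeness in L^2 thus implies closeness at
    each point.

    Two tools are developed on the way. Integration by parts for compactly
    supported C^1 functions follows from Fubini's theorem and the fundamental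
    theorem of calculus ([integral_partial1], [integral_partial2]). Test
    functions are C^infty whereas [w] is only C^1, so [w] is approximated in the
    C^1 norm by a smooth cutoff times Bernstein polynomials in two variables
    ([C1_test_approximation]), which extends the weak equation to [w]
    ([weak_equation_C1]). All comparison arguments go through the elementary
    maximum principle on rectangles ([minimum_principle]). *)

Set Implicit Arguments.
Unset Strict Implicit.
Unset Printing Implicit Defensive.

(** * One-variable calculus *)

Section OneVariable.
Context {R : realType}.
Implicit Types (f g : R -> R) (t l m c : R).

Lemma derivable_is_derive f t : derivable f t 1 -> is_derive t 1 f (derive1 f t).
Proof. by move=> df; rewrite derive1E; exact: derivableP. Qed.

Lemma is_derive_derive1 f t l : is_derive t 1 f l -> derive1 f t = l.
Proof. by move=> df; rewrite derive1E derive_val. Qed.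

(** The limit of a divergent quotient is the default point 0. *)
Lemma derive1_neq0_derivable f t : derive1 f t != 0 -> derivable f t 1.
Proof.
apply: contraNP => /dvgP nd; rewrite derive1E /derive nd.
exact/eqP.
Qed.

Lemma is_derive_ext f g t l m : is_derive t 1 f l -> f =1 g -> l = m ->
  is_derive t 1 g m.
Proof. by move=> df /funext <- <-. Qed.

Lemma is_derive_fcst c t : is_derive t 1 (fun _ : R => c) 0.
Proof. exact: is_derive_cst. Qed.

Lemma is_derive_fid t : is_derive t 1 (fun x : R => x) 1.
Proof. exact: is_derive_id. Qed.

Lemma is_derive_fD f g t l m : is_derive t 1 f l -> is_derive t 1 g m ->
  is_derive t 1 (fun x => f x + g x) (l + m).
Proof. by move=> ? ?; exact: is_deriveD. Qed.

Lemma is_derive_fM f g t l m : is_derive t 1 f l -> is_derive t 1 g m ->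
  is_derive t 1 (fun x => f x * g x) (l * g t + f t * m).
Proof.
move=> df dg; have h := is_deriveM df dg.
apply: (is_derive_eq h); rewrite /GRing.scale /=; ring.
Qed.

Lemma is_derive_fZ f c t l : is_derive t 1 f l ->
  is_derive t 1 (fun x => c * f x) (c * l).
Proof.
move=> df; apply: (is_derive_ext (is_derive_fM (is_derive_fcst c t) df)) => //.
by rewrite mul0r add0r.
Qed.

Lemma is_derive_fN f t l : is_derive t 1 f l ->
  is_derive t 1 (fun x => - f x) (- l).
Proof. by move=> ?; exact: is_deriveN. Qed.

Lemma is_derive_fB f g t l m : is_derive t 1 f l -> is_derive t 1 g m ->
  is_derive t 1 (fun x => f x - g x) (l - m).
Proof. by move=> ? ?; apply: is_derive_fD => //; exact: is_derive_fN. Qed.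

Lemma is_derive_fcomp f g t l m : is_derive t 1 f l -> is_derive (f t) 1 g m ->
  is_derive t 1 (fun x => g (f x)) (m * l).
Proof. by move=> df dg; have := is_derive1_comp (f := g) (g := f); apply. Qed.

Lemma is_derive_faff a b t : is_derive t 1 (fun x : R => a * x + b) a.
Proof.
apply: (is_derive_ext (is_derive_fD (is_derive_fZ a (is_derive_fid t)) (is_derive_fcst b t))) => //.
by rewrite mulr1 addr0.
Qed.

Lemma is_derive_fV f t l : f t != 0 -> is_derive t 1 f l ->
  is_derive t 1 (fun x => (f x)^-1) (- l / f t ^+ 2).
Proof.
move=> f0 df; apply: (is_derive_eq (is_deriveV f0 df)).
by rewrite /GRing.scale /= !mulNr mulrC.
Qed.

Lemma is_derive_near f g t l : (\forall s \near t, f s = g s) ->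
  is_derive t 1 f l -> is_derive t 1 g l.
Proof. by move=> fg; exact: near_eq_is_derive. Qed.

Lemma is_derive_quotient f t l e : is_derive t 1 f l -> 0 < e ->
  exists2 d : R, 0 < d & forall h, h != 0 -> `|h| < d ->
    `|(f (t + h) - f t) / h - l| < e.
Proof.
move=> df e0.
have /cvgrPdist_lt/(_ e e0) : (h^-1 *: (f (h *: 1 + t) - f t)) @[h --> 0^'] --> l.
  have [H <-] := df; exact: H.
move=> [d /= d0 H]; exists d => // h h0 hd.
have := H h; rewrite /ball/= sub0r normrN => /(_ hd h0).
by rewrite /GRing.scale/= mulr1 distrC (addrC h) mulrC.
Qed.

Lemma near_ball (P : R -> Prop) t : (\forall s \near t, P s) ->
  exists2 d : R, 0 < d & forall s, `|s - t| < d -> P s.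
Proof.
move=> [d /= d0 D]; exists d => // s sd; apply: D.
by rewrite /ball/= distrC.
Qed.

Lemma is_derive_continuous f t l : is_derive t 1 f l -> {for t, continuous f}.
Proof. by move=> df; apply/differentiable_continuous/derivable1_diffP. Qed.

Lemma mean_value f a b : a < b ->
  (forall x, a < x < b -> derivable f x 1) ->
  (forall x, a <= x <= b -> {for x, continuous f}) ->
  exists2 c, a < c < b & f b - f a = derive1 f c * (b - a).
Proof.
move=> ab df cf.
have [||c] := @MVT R f (derive1 f) a b ab.
- by move=> x; rewrite in_itv/= => /df; exact: derivable_is_derive.
- apply: continuous_in_subspaceT => x; rewrite inE/= in_itv/=; exact: cf.
- by rewrite in_itv/= => cab ->; exists c.
Qed.

(** A negative second derivative would make [derive1 g] negative to the right of
    [t], hence [g] smaller than [g t] there. *)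
Lemma second_derivative_min g t l : (\forall s \near t, derivable g s 1) ->
  is_derive t 1 (derive1 g) l -> (\forall s \near t, g t <= g s) -> 0 <= l.
Proof.
move=> /near_ball[d1 d10 H1] dg /near_ball[d2 d20 H2].
rewrite leNgt; apply/negP => l0.
have [d3 d30 H3] := is_derive_quotient dg (e := - l) ltac:(lra).
pose d := Num.min d1 (Num.min d2 d3).
have d0 : 0 < d by rewrite /d !lt_min d10 d20.
have [dd1 dd2 dd3] : [/\ d <= d1, d <= d2 & d <= d3] by rewrite /d !ge_min !lexx !orbT.
have g'0 : derive1 g t = 0.
  apply: is_derive_derive1; apply: (@derive1_at_min _ _ (t - d) (t + d)).
  - lra.
  - move=> s; rewrite in_itv/= => ?; apply: H1; rewrite ltr_norml; lra.
  - by rewrite in_itv/=; lra.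
  - move=> s; rewrite in_itv/= => ?; apply: H2; rewrite ltr_norml; lra.
have [|||c cc E] := @mean_value g t (t + d / 2); first lra.
- by move=> x xx; apply: H1; rewrite ltr_norml; lra.
- move=> x xx; apply/differentiable_continuous/derivable1_diffP/H1.
  by rewrite ltr_norml; lra.
have := H2 (t + d / 2); rewrite ltr_norml => /(_ ltac:(lra)) gd.
have := H3 (c - t); rewrite [t + _]addrC subrK g'0 subr0 ltr_norml.
rewrite ltr_norml => /(_ ltac:(lra) ltac:(lra)) /andP[_ ub].
have {}ub : derive1 g c / (c - t) < 0 by lra.
have : derive1 g c < 0 by move: ub; rewrite pmulr_llt0// invr_gt0; lra.
move=> gc; have : derive1 g c * (t + d / 2 - t) < 0 by rewrite nmulr_rlt0//; lra.
lra.
Qed.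

(** The derivative [derive1 g] increases through 0, so it is nonzero on at least
    one side of 0: there [g] is derivable, and strictly monotone in the
    direction that makes it exceed [g 0]. *)
Lemma convex_at0_not_max g : (forall t, `|t| < 1 -> {for t, continuous g}) ->
  0 < derive1 (derive1 g) 0 -> exists2 y, `|y| < 1 & g 0 < g y.
Proof.
move=> cg m0.
have dg := derivable_is_derive (derive1_neq0_derivable (lt0r_neq0 m0)).
have [d d0 H] := is_derive_quotient dg m0.
pose r := Num.min d 1 / 2.
have [r0 rd r1] : [/\ 0 < r, r < d & r < 1].
  have : Num.min d 1 <= d by rewrite ge_min lexx.
  have : Num.min d 1 <= 1 by rewrite ge_min lexx orbT.
  have : 0 < Num.min d 1 by rewrite lt_min d0 ltr01.
  by rewrite /r => *; split; lra.
have pos h : h != 0 -> `|h| < d -> 0 < (derive1 g h - derive1 g 0) / h.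
  move=> h0 hd; have := H h h0 hd; rewrite add0r ltr_norml; lra.
have [c0|c0] := leP 0 (derive1 g 0).
- have gp h : 0 < h < r -> 0 < derive1 g h.
    move=> h0; have hn : h != 0 by lra.
    have := pos h hn; rewrite ger0_norm; last lra.
    by move=> /(_ ltac:(lra)); rewrite pmulr_lgt0 ?invr_gt0; lra.
  have [|||c cc E] := @mean_value g 0 r => //.
  + by move=> x /gp /lt0r_neq0; exact: derive1_neq0_derivable.
  + by move=> x xr; apply: cg; rewrite ltr_norml; lra.
  exists r; first by rewrite ltr_norml; lra.
  rewrite -subr_gt0 E pmulr_lgt0; first exact: gp.
  lra.
- have gp h : - r < h < 0 -> derive1 g h < 0.
    move=> h0; have hn : h != 0 by lra.
    have := pos h hn; rewrite ltr0_norm; last lra.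
    by move=> /(_ ltac:(lra)); rewrite nmulr_lgt0 ?invr_lt0; lra.
  have [|||c cc E] := @mean_value g (- r) 0; first lra.
  + by move=> x /gp /ltr0_neq0; exact: derive1_neq0_derivable.
  + by move=> x xr; apply: cg; rewrite ltr_norml; lra.
  exists (- r); first by rewrite ltr_norml; lra.
  rewrite -subr_lt0 E nmulr_rlt0; last exact: gp.
  lra.
Qed.

End OneVariable.

(** * The maximum principle *)

Section SecondDerivatives.
Context {R : realType}.
Implicit Types (f g : R -> R) (t l m c : R).

(** Unlike the total [derive1], this relation carries the existence of the
    second derivative. *)
Definition is_d2 f t l :=
  (\forall s \near t, derivable f s 1) /\ is_derive t 1 (derive1 f) l.

Lemma is_d2D f g t l m : is_d2 f t l -> is_d2 g t m ->
  is_d2 (fun x => f x + g x) t (l + m).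
Proof.
move=> [nf df] [ng dg]; split.
  by apply: filterS2 nf ng => s fs gs; exact: derivableD.
apply: is_derive_near (is_derive_fD df dg).
apply: filterS2 nf ng => s fs gs.
apply/esym/is_derive_derive1; apply: is_derive_fD; exact: derivable_is_derive.
Qed.

Lemma is_d2Z f c t l : is_d2 f t l -> is_d2 (fun x => c * f x) t (c * l).
Proof.
move=> [nf df]; split.
  apply: filterS nf => s fs.
  by have [] := is_derive_fZ c (derivable_is_derive fs).
apply: is_derive_near (is_derive_fZ c df).
apply: filterS nf => s fs.
by apply/esym/is_derive_derive1/is_derive_fZ/derivable_is_derive.
Qed.

Lemma is_d2_affine f a b t l : is_d2 f (a * t + b) l ->
  is_d2 (fun x => f (a * x + b)) t (a ^+ 2 * l).
Proof.
move=> [nf df].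
have ca : (fun x : R => a * x + b) @ t --> a * t + b.
  exact: (is_derive_continuous (is_derive_faff a b t)).
have nf' : nbhs t (fun s => derivable f (a * s + b) 1) :=
  ca (fun x => derivable f x 1) nf.
split.
  apply: filterS nf' => s fs.
  by have [] := is_derive_fcomp (is_derive_faff a b s) (derivable_is_derive fs).
have h := is_derive_fZ a (is_derive_fcomp (is_derive_faff a b t) df).
apply: (@is_derive_near _ (fun x => a * derive1 f (a * x + b))).
  apply: filterS nf' => s fs; rewrite mulrC; apply/esym/is_derive_derive1.
  exact: (is_derive_fcomp (is_derive_faff a b s) (derivable_is_derive fs)).
by apply: (is_derive_ext h) => //; ring.
Qed.

Lemma is_d2_near f g t l : (\forall s \near t, f s = g s) -> is_d2 f t l ->
  is_d2 g t l.
Proof.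
move=> /near_join fg [nf df]; split.
  apply: filterS2 fg nf => s fgs fs.
  by have [] := is_derive_near fgs (derivable_is_derive fs).
apply: is_derive_near df; apply: filterS2 fg nf => s fgs fs.
apply/esym/is_derive_derive1/(is_derive_near fgs); exact: derivable_is_derive.
Qed.

Lemma is_d2_quad (a b c t : R) : is_d2 (fun x => a * x ^+ 2 + b * x + c) t (2 * a).
Proof.
have d1 (s : R) : is_derive s 1 (fun x => a * x ^+ 2 + b * x + c) (2 * a * s + b).
  have h := is_derive_fD (is_derive_fD (is_derive_fZ a
    (is_derive_fM (is_derive_fid s) (is_derive_fid s)))
    (is_derive_fZ b (is_derive_fid s))) (is_derive_fcst c s).
  by apply: (is_derive_ext h) => [x|]; [rewrite expr2|ring].
split; first by apply: filterE => s; have [] := d1 s.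
have -> : derive1 (fun x => a * x ^+ 2 + b * x + c) = fun s => 2 * a * s + b.
  by apply/funext => s; exact: is_derive_derive1.
exact: is_derive_faff.
Qed.

End SecondDerivatives.

Section Laplacian.
Context {R : realType}.
Implicit Types (f g h : R * R -> R) (p q : R * R) (A : set (R * R)).

Definition has_laplacian h p l := exists l1 l2,
  [/\ is_d2 (fun t => h (t, p.2)) p.1 l1,
      is_d2 (fun t => h (p.1, t)) p.2 l2 & l = l1 + l2].

Lemma has_laplacianD f g p l m : has_laplacian f p l -> has_laplacian g p m ->
  has_laplacian (fun q => f q + g q) p (l + m).
Proof.
move=> [l1 [l2 [fx fy ->]]] [m1 [m2 [gx gy ->]]].
exists (l1 + m1), (l2 + m2); split; [exact: is_d2D|exact: is_d2D|ring].
Qed.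

Lemma has_laplacianZ f c p l : has_laplacian f p l ->
  has_laplacian (fun q => c * f q) p (c * l).
Proof.
move=> [l1 [l2 [fx fy ->]]].
exists (c * l1), (c * l2); split; [exact: is_d2Z|exact: is_d2Z|ring].
Qed.

Lemma has_laplacian_ext f g p l m : has_laplacian f p l -> f =1 g -> l = m ->
  has_laplacian g p m.
Proof. by move=> hf /funext <- <-. Qed.

Lemma has_laplacianB f g p l m : has_laplacian f p l -> has_laplacian g p m ->
  has_laplacian (fun q => f q - g q) p (l - m).
Proof.
move=> hf /(has_laplacianZ (-1)) hg.
by apply: (has_laplacian_ext (has_laplacianD hf hg)) => [q|]; rewrite mulN1r.
Qed.

Lemma has_laplacian_quad (a b c d : R) p :
  has_laplacian (fun q => a * q.1 ^+ 2 + b * q.1 + c * q.2 ^+ 2 + d) p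
    (2 * a + 2 * c).
Proof.
exists (2 * a), (2 * c); split => //=.
  have := is_d2_quad a b (c * p.2 ^+ 2 + d) p.1.
  by apply: is_d2_near; apply: filterE => s; rewrite addrA.
have := is_d2_quad c 0 (a * p.1 ^+ 2 + b * p.1 + d) p.2.
by apply: is_d2_near; apply: filterE => s; ring.
Qed.

Lemma has_laplacian_affine f (s u t v : R) p l : s ^+ 2 = 1 -> t ^+ 2 = 1 ->
  has_laplacian f (s * p.1 + u, t * p.2 + v) l ->
  has_laplacian (fun q => f (s * q.1 + u, t * q.2 + v)) p l.
Proof.
move=> s1 t1 [l1 [l2 /= [fx fy ->]]]; exists l1, l2; split => //=.
  by have := is_d2_affine fx; rewrite s1 mul1r.
by have := is_d2_affine fy; rewrite t1 mul1r.
Qed.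

Lemma cvg_xslice p : (fun t => (t, p.2)) @ p.1 --> p.
Proof.
case: p => x y /=.
apply: (@cvg_pair _ _ _ (nbhs x) (nbhs x) (nbhs y) _ _ _ id (fun=> y)).
- exact: cvg_id.
- exact: cvg_cst.
Qed.

Lemma cvg_yslice p : (fun t => (p.1, t)) @ p.2 --> p.
Proof.
case: p => x y /=.
apply: (@cvg_pair _ _ _ (nbhs y) (nbhs x) (nbhs y) _ _ _ (fun=> x) id).
- exact: cvg_cst.
- exact: cvg_id.
Qed.

Lemma near_xslice p (P : set (R * R)) : (\forall q \near p, P q) ->
  \forall t \near p.1, P (t, p.2).
Proof. by move=> nP; exact: (@cvg_xslice p). Qed.

Lemma near_yslice p (P : set (R * R)) : (\forall q \near p, P q) ->
  \forall t \near p.2, P (p.1, t).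
Proof. by move=> nP; exact: (@cvg_yslice p). Qed.

Lemma continuous_fst p : {for p, continuous (fun q : R * R => q.1)}.
Proof. by case: p => x y; exact: cvg_fst. Qed.

Lemma continuous_snd p : {for p, continuous (fun q : R * R => q.2)}.
Proof. by case: p => x y; exact: cvg_snd. Qed.

Lemma has_laplacian_near f g p l : (\forall q \near p, f q = g q) ->
  has_laplacian f p l -> has_laplacian g p l.
Proof.
move=> fg [l1 [l2 /= [fx fy ->]]]; exists l1, l2; split => //=.
  exact: (is_d2_near (near_xslice fg)).
exact: (is_d2_near (near_yslice fg)).
Qed.

Lemma C2_has_laplacian A f p : open A -> Ck_on 2 A f -> A p ->
  has_laplacian f p (laplacian f p).
Proof.
move=> oA [_ [dfx dfy [_ [dxx _ _ _]] [_ [_ dyy _ _]]]] Ap.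
have nA : \forall q \near p, A q by exact: open_nbhs_nbhs.
exists (dx (dx f) p), (dy (dy f) p); split; [split|split|by rewrite /laplacian].
- have := near_xslice nA; apply: filterS => t; exact: dfx.
- exact: (derivable_is_derive (dxx p Ap)).
- have := near_yslice nA; apply: filterS => t; exact: dfy.
- exact: (derivable_is_derive (dyy p Ap)).
Qed.

Lemma continuous_quad (a b c d : R) p :
  {for p, continuous (fun q : R * R => a * q.1 ^+ 2 + b * q.1 + c * q.2 ^+ 2 + d)}.
Proof.
have c1 := @continuous_fst p; have c2 := @continuous_snd p.
apply: cvgD; last exact: cvg_cst.
apply: cvgD; last by apply: cvgM; [exact: cvg_cst|exact: cvgM].
by apply: cvgD; apply: cvgM; (try exact: cvg_cst); [exact: cvgM|exact: c1].
Qed.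

Definition rectangle (a b c d : R) : set (R * R) :=
  `[a, b]%classic `*` `[c, d]%classic.

Lemma compact_rectangle a b c d : compact (rectangle a b c d).
Proof. by apply: compact_setX; exact: segment_compact. Qed.

Lemma rectangleP a b c d p :
  rectangle a b c d p <-> a <= p.1 <= b /\ c <= p.2 <= d.
Proof. by rewrite /rectangle /setX/= !in_itv/=. Qed.

Lemma rectangle_radiusP p q (r : R) :
  rectangle (p.1 - r) (p.1 + r) (p.2 - r) (p.2 + r) q <->
  `|q.1 - p.1| <= r /\ `|q.2 - p.2| <= r.
Proof. by rewrite !ler_distl; exact: rectangleP. Qed.

(** Subtracting a small multiple of the squared norm makes the Laplacian
    negative; the minimum of the perturbed function over the rectangle then
    cannot sit where the Laplacian is controlled. *)
Lemma minimum_principle a b c d h :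
  (forall p, rectangle a b c d p -> {for p, continuous h}) ->
  (forall p, rectangle a b c d p -> 0 <= h p \/
     [/\ a < p.1 < b, c < p.2 < d & exists2 l, l <= 0 & has_laplacian h p l]) ->
  forall p, rectangle a b c d p -> 0 <= h p.
Proof.
move=> ch hh p0 Kp0; rewrite leNgt; apply/negP => hp0.
pose M := a ^+ 2 + b ^+ 2 + c ^+ 2 + d ^+ 2 + 1.
have M0 : 0 < M.
  rewrite /M; have := sqr_ge0 a; have := sqr_ge0 b.
  have := sqr_ge0 c; have := sqr_ge0 d; lra.
have sq_le (s t x : R) : s <= x <= t -> x ^+ 2 <= s ^+ 2 + t ^+ 2.
  by move=> st; have [x0|x0] := leP 0 x; nra.
pose tau := - h p0 / (2 * M).
have tau0 : 0 < tau by rewrite divr_gt0//; lra.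
have tauM : tau * M = - h p0 / 2 by rewrite /tau; field; lra.
pose H := fun q : R * R => h q + (- tau * q.1 ^+ 2 + 0 * q.1 + - tau * q.2 ^+ 2 + 0).
have cH : {within rectangle a b c d, continuous H}.
  apply: continuous_in_subspaceT => q; rewrite inE => Kq.
  by rewrite /H; apply: cvgD; [exact: ch|exact: continuous_quad].
have [|[x y]] := compact_EVT_min _ (@compact_rectangle a b c d) cH.
  by exists p0.
pose q := (x, y); rewrite -/q inE => Kq min_q.
have HE r : H r = h r - tau * (r.1 ^+ 2 + r.2 ^+ 2) by rewrite /H; ring.
have hq : h q < 0.
  have := min_q p0; rewrite inE => /(_ Kp0); rewrite !HE => Hq.
  have /rectangleP[/sq_le q1 /sq_le q2] := Kq.
  have : tau * (q.1 ^+ 2 + q.2 ^+ 2) <= tau * M by rewrite ler_pM2l// /M; lra.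
  have : 0 <= tau * (p0.1 ^+ 2 + p0.2 ^+ 2).
    by rewrite mulr_ge0 ?addr_ge0 ?sqr_ge0// ltW.
  lra.
have [|[q1 q2 [l l0 lap]]] := hh q Kq; first by lra.
have [l1 [l2 [/= Hx Hy lE]]] := has_laplacianD lap (has_laplacian_quad (- tau) 0 (- tau) 0 q).
have x0 : 0 <= l1.
  apply: (second_derivative_min Hx.1 Hx.2).
  have : q.1 \in `]a, b[ by rewrite in_itv.
  move=> /near_in_itvoo; apply: filterS => t; rewrite in_itv/= => tab.
  have := min_q (t, q.2); rewrite inE; apply.
  by apply/rectangleP; move: q1 q2; rewrite /q/= => ? ?; split; lra.
have y0 : 0 <= l2.
  apply: (second_derivative_min Hy.1 Hy.2).
  have : q.2 \in `]c, d[ by rewrite in_itv.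
  move=> /near_in_itvoo; apply: filterS => t; rewrite in_itv/= => tcd.
  have := min_q (q.1, t); rewrite inE; apply.
  by apply/rectangleP; move: q1 q2; rewrite /q/= => ? ?; split; lra.
lra.
Qed.

End Laplacian.

(** * Solutions of the torsion problem *)

Section Torsion.
Context {R : realType}.
Implicit Types (v u : R * R -> R) (p q c : R * R) (A : set (R * R)).

Lemma continuous_affine2 v (s a t b : R) p :
  {for (s * p.1 + a, t * p.2 + b), continuous v} ->
  {for p, continuous (fun q => v (s * q.1 + a, t * q.2 + b))}.
Proof.
move=> cv; apply: (@continuous_comp _ _ _ (fun q : R * R => (s * q.1 + a, t * q.2 + b)) v) => //.
apply: (@cvg_pair _ _ _ (nbhs p) (nbhs (s * p.1 + a)) (nbhs (t * p.2 + b)) _ _ _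
   (fun q : R * R => s * q.1 + a) (fun q : R * R => t * q.2 + b)).
  by apply: cvgD; [apply: cvgM; [exact: cvg_cst|exact: continuous_fst]|exact: cvg_cst].
by apply: cvgD; [apply: cvgM; [exact: cvg_cst|exact: continuous_snd]|exact: cvg_cst].
Qed.

(** The difference between a solution and its mirror image across a vertical
    line is harmonic and vanishes on that line, so the harmonic polynomial
    y^2 + 2rx - x^2, which is at least r^2 on the three other sides of the
    rectangle [0,r] x [-r,r], is a barrier for it. *)
Lemma torsion_osc_horizontal v c (r t : R) : 0 < r -> 0 <= t <= r ->
  (forall q, rectangle (c.1 - r) (c.1 + r) (c.2 - r) (c.2 + r) q ->
    [/\ {for q, continuous v}, 0 <= v q <= 1 / 2 & has_laplacian v q (-1)]) ->
  `|v (c.1 + t, c.2) - v (c.1 - t, c.2)| <= t / r.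
Proof.
move=> r0 tr hv.
have e1 : (1 : R) ^+ 2 = 1 by rewrite expr1n.
have eN1 : (- 1 : R) ^+ 2 = 1 by rewrite sqrrN.
have k0 : 0 < (2 * r ^+ 2)^-1 by rewrite invr_gt0 mulr_gt0// exprn_gt0.
pose k := (2 * r ^+ 2)^-1.
have kr : k * r ^+ 2 = 1 / 2 by rewrite /k; field; lra.
have key (s : R) : s ^+ 2 = 1 ->
    0 <= (- k * t ^+ 2 + 2 * r * k * t + k * 0 ^+ 2 + 0) -
         s * (v (1 * t + c.1, 1 * 0 + c.2) - v (-1 * t + c.1, 1 * 0 + c.2)).
  move=> s1; pose h q := (- k * q.1 ^+ 2 + 2 * r * k * q.1 + k * q.2 ^+ 2 + 0) -
    s * (v (1 * q.1 + c.1, 1 * q.2 + c.2) - v (-1 * q.1 + c.1, 1 * q.2 + c.2)).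
  have in1 q : rectangle 0 r (- r) r q ->
      rectangle (c.1 - r) (c.1 + r) (c.2 - r) (c.2 + r) (1 * q.1 + c.1, 1 * q.2 + c.2).
    by move=> /rectangleP[? ?]; apply/rectangleP; split => /=; lra.
  have in2 q : rectangle 0 r (- r) r q ->
      rectangle (c.1 - r) (c.1 + r) (c.2 - r) (c.2 + r) (-1 * q.1 + c.1, 1 * q.2 + c.2).
    by move=> /rectangleP[? ?]; apply/rectangleP; split => /=; lra.
  apply: (@minimum_principle _ 0 r (- r) r h _ _ (t, 0)).
  - move=> q Kq; have [c1 _ _] := hv _ (in1 _ Kq); have [c2 _ _] := hv _ (in2 _ Kq).
    apply: cvgB; first exact: continuous_quad.
    by apply: cvgM; [exact: cvg_cst|apply: cvgB; exact: continuous_affine2].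
  - move=> q Kq; have [_ b1 l1] := hv _ (in1 _ Kq); have [_ b2 l2] := hv _ (in2 _ Kq).
    have /rectangleP[q1 q2] := Kq.
    have [/andP[i1 i2]|side] := boolP ((0 < q.1 < r) && (- r < q.2 < r)).
      right; split => //; exists 0 => //.
      have L := has_laplacianB (has_laplacian_quad (- k) (2 * r * k) k 0 q)
        (has_laplacianZ s (has_laplacianB
          (has_laplacian_affine (s := 1) (t := 1) e1 e1 l1)
          (has_laplacian_affine (s := -1) (t := 1) eN1 e1 l2))).
      by apply: (has_laplacian_ext L) => //; ring.
    left; have [q10|q10] := eqVneq q.1 0.
      rewrite /h q10 !mulr0 subrr mulr0 expr0n/= mulr0 !add0r subr0 addr0.
      by rewrite mulr_ge0 ?sqr_ge0// ltW.
    have s11 : (s == 1) || (s == -1) by rewrite -sqrf_eq1 s1.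
    have bar : 1 / 2 <= - k * q.1 ^+ 2 + 2 * r * k * q.1 + k * q.2 ^+ 2 + 0.
      have -> : - k * q.1 ^+ 2 + 2 * r * k * q.1 + k * q.2 ^+ 2 + 0 =
         k * (q.2 ^+ 2 + q.1 * (2 * r - q.1)) by ring.
      rewrite -kr ler_pM2l//.
      have [q1r|q1r] := eqVneq q.1 r.
        by rewrite q1r; have := sqr_ge0 q.2; nra.
      have [q2r|q2r] := eqVneq q.2 r; first by rewrite q2r; nra.
      have [q2r'|q2r'] := eqVneq q.2 (- r); first by rewrite q2r'; nra.
      by exfalso; move: side; rewrite !lt_neqAle ![_ == q.1]eq_sym [_ == q.2]eq_sym q10 q1r q2r q2r'/=; lra.
    by rewrite /h; case/orP: s11 => /eqP ->; lra.
  - by apply/rectangleP => /=; split; lra.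
have := key 1; have := key (-1).
rewrite sqrrN expr1n !mul1r !mulN1r !add0r !addr0 expr0n/= mulr0 !addr0.
rewrite [t + _]addrC [- t + _]addrC.
move=> /(_ erefl) k1 /(_ erefl) k2.
have kt : - k * t ^+ 2 + 2 * r * k * t <= t / r.
  have -> : t / r = 2 * r * k * t by rewrite /k; field; lra.
  by rewrite gerDr mulNr oppr_le0 mulr_ge0 ?sqr_ge0// ltW.
by rewrite ler_norml; lra.
Qed.

Lemma continuous_swap v p : {for (p.2, p.1), continuous v} ->
  {for p, continuous (fun q => v (q.2, q.1))}.
Proof.
move=> cv; apply: (@continuous_comp _ _ _ (fun q : R * R => (q.2, q.1)) v) => //.
apply: (@cvg_pair _ _ _ (nbhs p) (nbhs p.2) (nbhs p.1) _ _ _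
   (fun q : R * R => q.2) (fun q : R * R => q.1)).
  exact: continuous_snd.
exact: continuous_fst.
Qed.

(** The two coordinates are moved one after the other; the bound does not depend
    on the domain, which makes families of solutions equicontinuous. *)
Lemma torsion_osc v c (r s : R) q : 0 < r -> s <= r ->
  `|q.1 - c.1| <= s -> `|q.2 - c.2| <= s ->
  (forall q, rectangle (c.1 - 2 * r) (c.1 + 2 * r) (c.2 - 2 * r) (c.2 + 2 * r) q ->
    [/\ {for q, continuous v}, 0 <= v q <= 1 / 2 & has_laplacian v q (-1)]) ->
  `|v q - v c| <= s / r.
Proof.
case: q c => x y [x0 y0] /= r0 sr hx hy hv.
have e (d : R) : `|d| <= s -> `|d| / 2 / r <= s / r / 2.
  by move=> ds; rewrite mulrAC ler_pM2r ?invr_gt0// ler_pM2r ?invr_gt0//; lra.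
have H1 : `|v (x, y0) - v (x0, y0)| <= `|x - x0| / 2 / r.
  have := @torsion_osc_horizontal v ((x + x0) / 2, y0) r (`|x - x0| / 2) r0.
  rewrite /=; case: (ger0P (x - x0)) hx => hd hx.
    rewrite (_ : (x + x0) / 2 + (x - x0) / 2 = x); last by field.
    rewrite (_ : (x + x0) / 2 - (x - x0) / 2 = x0); last by field.
    apply; first lra.
    by move=> q /rectangleP[/= ? ?]; apply: hv; apply/rectangleP => /=; split; lra.
  rewrite (_ : (x + x0) / 2 + - (x - x0) / 2 = x0); last by field.
  rewrite (_ : (x + x0) / 2 - - (x - x0) / 2 = x); last by field.
  rewrite distrC; apply; first lra.
  by move=> q /rectangleP[/= ? ?]; apply: hv; apply/rectangleP => /=; split; lra.
have hv' q : rectangle (y0 - 2 * r) (y0 + 2 * r) (x0 - 2 * r) (x0 + 2 * r) q ->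
  [/\ {for q, continuous (fun q => v (q.2, q.1))}, 0 <= v (q.2, q.1) <= 1 / 2 &
     has_laplacian (fun q => v (q.2, q.1)) q (-1)].
  move=> /rectangleP[? ?].
  have [|cv bv [l1 [l2 [/= d1 d2 dE]]]] := hv (q.2, q.1).
    by apply/rectangleP.
  split=> //; first exact: continuous_swap.
  by exists l2, l1; split => //; rewrite addrC.
have H2 : `|v (x, y) - v (x, y0)| <= `|y - y0| / 2 / r.
  have := @torsion_osc_horizontal (fun q => v (q.2, q.1)) ((y + y0) / 2, x) r (`|y - y0| / 2) r0.
  rewrite /=; case: (ger0P (y - y0)) hy => hd hy.
    rewrite (_ : (y + y0) / 2 + (y - y0) / 2 = y); last by field.
    rewrite (_ : (y + y0) / 2 - (y - y0) / 2 = y0); last by field.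
    apply; first lra.
    move=> q /rectangleP[/= ? ?]; apply: hv'; apply/rectangleP => /=.
    by move: hx; rewrite ler_norml => ?; split; lra.
  rewrite (_ : (y + y0) / 2 + - (y - y0) / 2 = y0); last by field.
  rewrite (_ : (y + y0) / 2 - - (y - y0) / 2 = y); last by field.
  rewrite distrC; apply; first lra.
  move=> q /rectangleP[/= ? ?]; apply: hv'; apply/rectangleP => /=.
  by move: hx; rewrite ler_norml => ?; split; lra.
have := ler_normD (v (x, y) - v (x, y0)) (v (x, y0) - v (x0, y0)).
rewrite addrA subrK; have := e _ hx; have := e _ hy; lra.
Qed.

End Torsion.

Section ZeroExtension.
Context {R : realType}.
Variables (A : set (R * R)) (u : R * R -> R).
Hypotheses (oA : open A) (Adisk : A `<=` disk) (solu : classical_solution A u).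

Lemma disk_bounds (p : R * R) : disk p -> -1 < p.1 < 1 /\ -1 < p.2 < 1.
Proof.
rewrite /disk/= /enorm => p1.
have {p1} : p.1 ^+ 2 + p.2 ^+ 2 < 1.
  rewrite ltNge; apply/negP => h; move: p1; rewrite ltNge => /negP; apply.
  by rewrite -[leLHS]sqrtr1 ler_wsqrtr.
by move: (sqr_ge0 p.1) (sqr_ge0 p.2) => ? ? ?; split; apply/andP; split; nra.
Qed.

Let uh : R * R -> R := u \_ A.

Lemma zero_ext_in p : A p -> uh p = u p.
Proof. by move=> Ap; rewrite /uh patchT// inE. Qed.

Lemma zero_ext_out p : ~ A p -> uh p = 0.
Proof. by move=> Ap; rewrite /uh patchC// inE. Qed.

(** Extending by zero turns boundary conditions into pointwise facts off [A],
    so that the maximum principle can always be applied on a rectangle. *)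
Lemma zero_ext_continuous p : {for p, continuous uh}.
Proof.
have [[cu _] cbar _ bdry] := solu.
have [Ap|nAp] := pselect (A p).
  have : \forall q \near p, u q = uh q.
    have : \forall q \near p, A q by exact: open_nbhs_nbhs.
    by apply: filterS => q Aq; rewrite zero_ext_in.
  move=> E; change (uh @ p --> uh p); rewrite (zero_ext_in Ap).
  exact: cvg_trans (near_eq_cvg E) (cu p Ap).
change (uh @ p --> uh p); rewrite (zero_ext_out nAp).
have [Cp|nCp] := pselect (closure A p); last first.
  have : \forall q \near p, 0 = uh q.
    have : \forall q \near p, (~` closure A) q.
      apply: open_nbhs_nbhs; split => //.
      by apply: closed_openC; exact: closed_closure.
    apply: filterS => q nq; rewrite zero_ext_out// => Aq.
    by apply: nq; exact: subset_closure.
  move=> E; exact: cvg_trans (near_eq_cvg E) (cvg_cst _).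
have up0 : u p = 0 by apply: bdry; split => //; rewrite (interior_id A).1.
have cp : u @ within (closure A) (nbhs p) --> (0 : R).
  by rewrite -up0; exact: ((subspace_continuousP _ _).1 cbar).
apply/cvgrPdist_lt => e e0.
have /cvgrPdist_lt/(_ e e0) := cp.
rewrite near_withinE; apply: filterS => q Hq.
have [Aq|nAq] := pselect (A q); last by rewrite zero_ext_out// subrr normr0.
by rewrite zero_ext_in//; apply: Hq; exact: subset_closure.
Qed.

Lemma zero_ext_laplacian p : A p -> has_laplacian uh p (-1).
Proof.
move=> Ap; have [C2 _ eqn _] := solu.
have : \forall q \near p, u q = uh q.
  have : \forall q \near p, A q by exact: open_nbhs_nbhs.
  by apply: filterS => q Aq; rewrite zero_ext_in.
move=> E; apply: (has_laplacian_near E).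
apply: (has_laplacian_ext (C2_has_laplacian oA C2 Ap)) => //.
by rewrite -[LHS]opprK eqn.
Qed.

Let inner p : A p -> -1 < p.1 < 1 /\ -1 < p.2 < 1.
Proof. by move=> /Adisk; exact: disk_bounds. Qed.

Let square p := rectangle (-1 : R) 1 (-1) 1 p.

Let square_or_out p : square p \/ ~ A p.
Proof.
have [Ap|] := pselect (A p); [left|by right].
by have [? ?] := inner Ap; apply/rectangleP; split; lra.
Qed.

Lemma zero_ext_ge0 p : 0 <= uh p.
Proof.
have [Sp|nA] := square_or_out p; last by rewrite zero_ext_out.
apply: (minimum_principle (a := -1) (b := 1) (c := -1) (d := 1)) Sp => q _.
  exact: zero_ext_continuous.
have [Aq|nA] := pselect (A q); last by left; rewrite zero_ext_out.
have [? ?] := inner Aq; right; split => //; exists (-1); first lra.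
exact: zero_ext_laplacian.
Qed.

(** Comparison with [1/2 - (x^2 + y^2)/4], which solves the same equation and is
    nonnegative on the square. *)
Lemma zero_ext_le p : uh p <= 1 / 2.
Proof.
have [Sp|nA] := square_or_out p; last by rewrite zero_ext_out//; lra.
suff : 0 <= (- (1/4) * p.1 ^+ 2 + 0 * p.1 + - (1/4) * p.2 ^+ 2 + 1 / 2) - uh p.
  by have := sqr_ge0 p.1; have := sqr_ge0 p.2; lra.
apply: (minimum_principle (a := -1) (b := 1) (c := -1) (d := 1)
  (h := fun p => (- (1/4) * p.1 ^+ 2 + 0 * p.1 + - (1/4) * p.2 ^+ 2 + 1 / 2) - uh p)) Sp => q Sq.
  by apply: cvgB; [exact: continuous_quad|exact: zero_ext_continuous].
have [Aq|nA] := pselect (A q).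
  have [? ?] := inner Aq; right; split => //; exists 0 => //.
  apply: (has_laplacian_ext (has_laplacianB
    (has_laplacian_quad (- (1/4)) 0 (- (1/4)) (1/2) q) (zero_ext_laplacian Aq))) => //.
  by field.
left; rewrite zero_ext_out//.
have /rectangleP[? ?] := Sq.
have [? ?] : q.1 ^+ 2 <= 1 /\ q.2 ^+ 2 <= 1 by split; nra.
lra.
Qed.

(** Comparison with the mirror image: both solve the same equation where [A]
    is, so their difference is harmonic there. *)
Lemma zero_ext_symmetric (s t : R) : s ^+ 2 = 1 -> t ^+ 2 = 1 ->
  (forall p, A p -> A (s * p.1 + 0, t * p.2 + 0)) ->
  forall p, uh (s * p.1 + 0, t * p.2 + 0) = uh p.
Proof.
move=> s1 t1 symA.
have le p : uh p <= uh (s * p.1 + 0, t * p.2 + 0).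
  have [Sp|nA] := square_or_out p; last by rewrite zero_ext_out ?zero_ext_ge0.
  rewrite -subr_ge0.
  apply: (minimum_principle (a := -1) (b := 1) (c := -1) (d := 1)
    (h := fun p => uh (s * p.1 + 0, t * p.2 + 0) - uh p)) Sp => q Sq.
    apply: cvgB; last exact: zero_ext_continuous.
    by apply: continuous_affine2; exact: zero_ext_continuous.
  have [Aq|nA] := pselect (A q).
    have [? ?] := inner Aq; right; split => //; exists 0 => //.
    have L := has_laplacianB (has_laplacian_affine s1 t1
      (zero_ext_laplacian (symA q Aq))) (zero_ext_laplacian Aq).
    by apply: (has_laplacian_ext L) => //; ring.
  by left; rewrite (zero_ext_out nA) subr0 zero_ext_ge0.
move=> p; apply/le_anti; rewrite le andbT.
have := le (s * p.1 + 0, t * p.2 + 0); rewrite /= !addr0.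
by rewrite !mulrA -!expr2 s1 t1 !mul1r -surjective_pairing.
Qed.

(** The equation is linear with a constant right-hand side, so the difference
    with the mirror image across the line [x = l] is harmonic to the right of
    that line, zero on it, and nonnegative where the solution vanishes. *)
Lemma zero_ext_reflection l p :
  (forall p, A p -> l < p.1 -> A (-1 * p.1 + 2 * l, 1 * p.2 + 0)) ->
  l <= p.1 -> uh p <= uh (-1 * p.1 + 2 * l, 1 * p.2 + 0).
Proof.
move=> refA lp; have [/rectangleP[Sp1 Sp2]|nA] := square_or_out p; last by rewrite zero_ext_out ?zero_ext_ge0.
rewrite -subr_ge0.
have e1 : (1 : R) ^+ 2 = 1 by rewrite expr1n.
have eN1 : (- 1 : R) ^+ 2 = 1 by rewrite sqrrN.
apply: (@minimum_principle _ l 1 (-1) 1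
    (fun p => uh (-1 * p.1 + 2 * l, 1 * p.2 + 0) - uh p)) => [q Sq|q Sq|].
- apply: cvgB; last exact: zero_ext_continuous.
  by apply: continuous_affine2; exact: zero_ext_continuous.
- have [Aq|nA] := pselect (A q); last by left; rewrite (zero_ext_out nA) subr0 zero_ext_ge0.
  have [? ?] := inner Aq; have /rectangleP[ql _] := Sq.
  have [lq|ql'] := ltP l q.1; last first.
    left; have -> : -1 * q.1 + 2 * l = q.1 by lra.
    by rewrite mul1r addr0 -surjective_pairing subrr.
  right; split => //; first lra.
  exists 0 => //.
  have L := has_laplacianB (has_laplacian_affine eN1 e1
      (zero_ext_laplacian (refA q Aq lq))) (zero_ext_laplacian Aq).
  by apply: (has_laplacian_ext L) => //; ring.
- by apply/rectangleP; split; lra.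
Qed.

End ZeroExtension.

(** * Integration in the plane *)

Section PlaneMeasure.
Context {R : realType}.
Implicit Types (f g F : R * R -> R) (D U : set (R * R)) (p q : R * R).

Lemma continuous2_ball f p e : {for p, continuous f} -> 0 < e ->
  exists2 d : R, 0 < d & forall q, `|q.1 - p.1| < d -> `|q.2 - p.2| < d ->
    `|f q - f p| < e.
Proof.
move=> /cvgrPdist_lt/(_ e) H e0.
have [[A B] /= [[d1 /= d10 H1] [d2 /= d20 H2]] AB] := H e0.
exists (Num.min d1 d2); first by rewrite lt_min d10.
move=> q; rewrite !lt_min => /andP[q1 _] /andP[_ q2]; rewrite distrC.
by apply: (AB q); split => /=; [apply: H1|apply: H2]; rewrite /ball/= distrC.
Qed.

Lemma open_rectangle U p : open U -> U p ->
  exists2 d : R, 0 < d & rectangle (p.1 - d) (p.1 + d) (p.2 - d) (p.2 + d) `<=` U.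
Proof.
move=> oU Up; have : nbhs p U by exact: open_nbhs_nbhs.
move=> [[A B] /= [[d1 /= d10 H1] [d2 /= d20 H2]] AB].
exists (Num.min d1 d2 / 2); first by rewrite divr_gt0// lt_min d10.
have d0 : 0 < Num.min d1 d2 by rewrite lt_min d10.
have dd1 : Num.min d1 d2 <= d1 by rewrite ge_min lexx.
have dd2 : Num.min d1 d2 <= d2 by rewrite ge_min lexx orbT.
move=> q /rectangleP[q1 q2]; apply: AB; split => /=.
  by apply: H1; rewrite /ball/= ltr_norml; lra.
by apply: H2; rewrite /ball/= ltr_norml; lra.
Qed.

Lemma measurable_rectangle (a b c d : R) :
  measurable (rectangle a b c d : set (@plane R)).
Proof. by apply: measurableX; exact: measurable_itv. Qed.

(** An open set is the union of the rational rectangles that it contains. *)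
Lemma measurable_open_plane U : open U -> measurable (U : set (@plane R)).
Proof.
move=> oU.
pose S (a b c d : rat) : set (@plane R) :=
  [set p | rectangle (ratr a) (ratr b) (ratr c) (ratr d) p /\
     rectangle (ratr a) (ratr b) (ratr c) (ratr d) `<=` U].
have -> : U = \bigcup_a \bigcup_b \bigcup_c \bigcup_d S a b c d.
  apply/seteqP; split=> [p Up|p [a _ [b _ [c _ [d _ [pr]]]]]]; last exact.
  have [e e0 eU] := open_rectangle oU Up.
  have rat_in (x y : R) : x < y -> exists2 q : rat, x < ratr q & ratr q < y.
    by move=> /rat_in_itvoo[q]; rewrite in_itv/= => /andP[? ?]; exists q.
  have [a a1 a2] := rat_in (p.1 - e) p.1 ltac:(lra).
  have [b b1 b2] := rat_in p.1 (p.1 + e) ltac:(lra).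
  have [c c1 c2] := rat_in (p.2 - e) p.2 ltac:(lra).
  have [d d1 d2] := rat_in p.2 (p.2 + e) ltac:(lra).
  exists a => //; exists b => //; exists c => //; exists d => //; split.
    by apply/rectangleP; split; lra.
  move=> q /rectangleP[q1 q2]; apply: eU; apply/rectangleP; split; lra.
apply: bigcupT_measurable_rat => a; apply: bigcupT_measurable_rat => b.
apply: bigcupT_measurable_rat => c; apply: bigcupT_measurable_rat => d.
have [sub|nsub] := pselect (rectangle (ratr a) (ratr b) (ratr c) (ratr d) `<=` U).
  rewrite (_ : S _ _ _ _ = rectangle (ratr a) (ratr b) (ratr c) (ratr d)).
    exact: measurable_rectangle.
  by apply/seteqP; split => [p []|p].
by rewrite (_ : S _ _ _ _ = set0)//; apply/seteqP; split => [p []|p].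
Qed.

Definition measurable2 D f := measurable_fun (D : set (@plane R)) (f : @plane R -> R).

Lemma continuous_measurable2 D f : measurable (D : set (@plane R)) ->
  (forall p, {for p, continuous f}) -> measurable2 D f.
Proof.
move=> mD cf; apply: measurable_funTS.
apply: (measurability _ (RGenOpens.measurableE R)).
move=> _ [_ [a [b ->] <-]]; rewrite setTI.
apply: measurable_open_plane; apply: open_comp; last exact: interval_open.
by move=> p _; exact: cf.
Qed.

Lemma leb2_rectangle (a b c d : R) : a < b -> c < d ->
  leb2 (rectangle a b c d) = ((b - a) * (d - c))%:E.
Proof.
move=> ab cd.
have := @product_measure1E _ _ _ _ R (@lebesgue_measure R) (@lebesgue_measure R)
  `[a, b]%classic `[c, d]%classic (measurable_itv _) (measurable_itv _).
move=> h; apply: (eq_trans h).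
have L (x y : R) : x < y -> @lebesgue_measure R `[x, y]%classic = (y - x)%:E.
  by move=> xy; rewrite lebesgue_measure_itv /= lte_fin xy EFinB.
by move: (L a b ab) (L c d cd) => /= -> ->; rewrite EFinM.
Qed.

Definition integrable2 D f :=
  (@leb2 R).-integrable (D : set (@plane R)) (EFin \o (f : @plane R -> R)).

Definition integral2 D f : R := Rintegral (@leb2 R) (D : set (@plane R)) (f : @plane R -> R).

Section OnDomain.
Variable D : set (R * R).
Hypothesis mD : measurable (D : set (@plane R)).

Lemma integrable2D f g : integrable2 D f -> integrable2 D g ->
  integrable2 D (fun p => f p + g p).
Proof. by move=> hf hg; exact: (integrableD mD hf hg). Qed.

Lemma integrable2Z f (k : R) : integrable2 D f -> integrable2 D (fun p => k * f p).
Proof. by move=> hf; exact: (integrableZl mD k hf). Qed.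

Lemma integrable2B f g : integrable2 D f -> integrable2 D g ->
  integrable2 D (fun p => f p - g p).
Proof. by move=> hf hg; exact: (integrableB mD hf hg). Qed.

Lemma integral2D f g : integrable2 D f -> integrable2 D g ->
  integral2 D (fun p => f p + g p) = integral2 D f + integral2 D g.
Proof. by move=> hf hg; exact: RintegralD. Qed.

Lemma integral2Z f (k : R) : integrable2 D f ->
  integral2 D (fun p => k * f p) = k * integral2 D f.
Proof. by move=> hf; exact: RintegralZl. Qed.

Lemma integral2B f g : integrable2 D f -> integrable2 D g ->
  integral2 D (fun p => f p - g p) = integral2 D f - integral2 D g.
Proof. by move=> hf hg; exact: RintegralB. Qed.

Lemma le_integral2 f g : integrable2 D f -> integrable2 D g ->
  (forall p, D p -> f p <= g p) -> integral2 D f <= integral2 D g.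
Proof. by move=> hf hg fg; exact: (le_Rintegral mD hf hg fg). Qed.

Lemma integral2_ge0 f : (forall p, D p -> 0 <= f p) -> 0 <= integral2 D f.
Proof. by move=> hf; exact: Rintegral_ge0. Qed.

Lemma eq_integral2 f g : (forall p, D p -> f p = g p) -> integral2 D f = integral2 D g.
Proof. by move=> fg; apply: eq_Rintegral => p /set_mem; exact: fg. Qed.

Lemma eq_integrable2 f g : (forall p, D p -> f p = g p) -> integrable2 D f -> integrable2 D g.
Proof. by move=> fg; apply: eq_integrable => // p /set_mem Dp /=; rewrite fg. Qed.

Lemma le_integrable2 f g : measurable2 D f -> (forall p, D p -> `|f p| <= g p) ->
  integrable2 D g -> integrable2 D f.
Proof.
move=> mf fg; apply: le_integrable => //; first exact/measurable_EFinP.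
by move=> p Dp /=; rewrite lee_fin (le_trans (fg p Dp))// ler_norm.
Qed.

Hypothesis fD : (leb2 (D : set (@plane R)) < +oo)%E.

Lemma bounded_integrable2 f (M : R) : measurable2 D f ->
  (forall p, D p -> `|f p| <= M) -> integrable2 D f.
Proof.
move=> mf fM; apply: measurable_bounded_integrable => //.
exists M; split; first exact: num_real.
by move=> x Mx p Dp /=; rewrite (le_trans (fM p Dp))// ltW.
Qed.

Lemma cst_integrable2 (k : R) : integrable2 D (fun _ => k).
Proof.
apply: (@bounded_integrable2 _ `|k|) => //.
by apply: continuous_measurable2 => // p; exact: cvg_cst.
Qed.

(** A square-integrable function is integrable against bounded functions, since
    |f| <= 1 + f^2 on a set of finite measure. *)
Lemma bounded_mul_integrable2 f g (M : R) : measurable2 D f -> measurable2 D g ->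
  integrable2 D (fun p => f p ^+ 2) -> (forall p, D p -> `|g p| <= M) ->
  integrable2 D (fun p => f p * g p).
Proof.
move=> mf mg f2 gM.
apply: (@le_integrable2 _ (fun p => `|M| * (1 + f p ^+ 2))).
- exact: measurable_funM.
- move=> p Dp; rewrite normrM mulrC; apply: ler_pM => //.
    by rewrite (le_trans (gM p Dp))// ler_norm.
  have := sqr_ge0 (`|f p| - 1); rewrite -(real_normK (num_real (f p))); nra.
by apply: integrable2Z; apply: integrable2D => //; exact: cst_integrable2.
Qed.

Lemma L2_integrable2 f : measurable2 D f -> (L2_sq D f < +oo)%E ->
  integrable2 D (fun p => f p ^+ 2).
Proof.
move=> mf L2; apply/integrableP; split.
  by apply/measurable_EFinP; apply: measurable_funX.
rewrite [ltLHS](_ : _ = L2_sq D f)//; apply: eq_integral => p _ /=.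
by rewrite ger0_norm ?sqr_ge0.
Qed.

Lemma L2_integral2 f : L2_sq D f \is a fin_num ->
  L2_sq D f = (integral2 D (fun p => f p ^+ 2))%:E.
Proof. by move=> ffin; rewrite /integral2 /Rintegral fineK. Qed.

End OnDomain.

End PlaneMeasure.

Section Divergence.
Context {R : realType}.
Implicit Types (f g F : R * R -> R) (D U : set (R * R)) (p q : R * R).

Definition unit_square : set (R * R) := rectangle (-1) 1 (-1) 1.

Lemma leb2_unit_square_subset D : measurable (D : set (@plane R)) ->
  D `<=` unit_square -> (leb2 (D : set (@plane R)) < +oo)%E.
Proof.
move=> mD DS; apply: le_lt_trans (_ : (leb2 (unit_square : set (@plane R)) < +oo)%E).
  by apply: le_measure => //; rewrite inE//; exact: measurable_rectangle.
by rewrite leb2_rectangle ?ltry//; lra.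
Qed.

Lemma continuous_bounded_rectangle f (a b c d : R) :
  (forall p, {for p, continuous f}) ->
  exists2 M, 0 <= M & forall p, rectangle a b c d p -> `|f p| <= M.
Proof.
move=> cf; have [->|/set0P ne] := eqVneq (rectangle a b c d) set0.
  by exists 0.
have [|m _ hm] := compact_EVT_max (f := fun p => `|f p|) ne (@compact_rectangle R a b c d).
  apply: continuous_subspaceT => p.
  by apply: continuous_comp; [exact: cf|exact: norm_continuous].
by exists `|f m| => // p rp; apply: hm; rewrite inE.
Qed.

Lemma near_notin_compact (K : set (R * R)) p : compact K -> ~ K p ->
  \forall q \near p, ~ K q.
Proof.
move=> cK nK; apply: open_nbhs_nbhs; split => //.
by apply: closed_openC; apply: compact_closed.
Qed.

Lemma integral_lebesgue_derivative (F f : R -> R) :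
  (forall t : R, is_derive t 1 F (f t)) -> continuous f ->
  (forall t, ~ (-1 <= t <= 1) -> F t = 0) ->
  (forall t, ~ (-1 <= t <= 1) -> f t = 0) ->
  (\int[@lebesgue_measure R]_t (f t)%:E = 0)%E.
Proof.
move=> dF cf F0 f0.
have cF t : F x @[x --> t] --> F t by exact: (is_derive_continuous (dF t)).
transitivity (\int[@lebesgue_measure R]_(t in `[(-2)%R, 2%R]) (f t)%:E)%E.
  rewrite [RHS]integral_mkcond; apply: eq_integral => t _; rewrite patchE.
  case: ifPn => //; rewrite notin_setE/= in_itv/= => nt.
  by rewrite f0// => t1; apply: nt; lra.
rewrite (@continuous_FTC2 _ f F).
- by rewrite !F0 ?subee//; lra.
- lra.
- exact: continuous_subspaceT.
- split.
  + by move=> t _; have [] := dF t.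
  + exact: cvg_at_right_filter.
  + exact: cvg_at_left_filter.
- by move=> t _; exact: is_derive_derive1.
Qed.

Section Compact.
Variables (F1 : R * R -> R) (D : set (R * R)).
Hypothesis cF1 : forall p, {for p, continuous F1}.
Hypothesis sF1 : forall p, ~ unit_square p -> F1 p = 0.

Let square_measurable : measurable (unit_square : set (@plane R)).
Proof. exact: measurable_rectangle. Qed.

Let square_finite : (leb2 (unit_square : set (@plane R)) < +oo)%E.
Proof. exact: leb2_unit_square_subset. Qed.

Lemma compact_supp_integrable2T : integrable2 setT F1.
Proof.
have [M M0 FM] := @continuous_bounded_rectangle F1 (-1) 1 (-1) 1 cF1.
have : integrable2 unit_square F1.
  apply: (@bounded_integrable2 _ _ square_measurable square_finite _ M) => //.
  exact: continuous_measurable2.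
move=> /(integrable_mkcond _ square_measurable); apply: eq_integrable => // p _.
rewrite patchE; case: ifPn => //; rewrite notin_setE => np /=.
by rewrite sF1.
Qed.

Hypothesis mD : measurable (D : set (@plane R)).
Hypothesis zD : forall p, ~ D p -> F1 p = 0.

Lemma compact_supp_integrable2 : integrable2 D F1.
Proof. by apply: (integrableS _ mD _ compact_supp_integrable2T). Qed.

Lemma compact_supp_integral2 : integral2 D F1 = integral2 setT F1.
Proof.
rewrite /integral2 Rintegral_mkcond; apply: eq_Rintegral => p _.
rewrite patchE; case: ifPn => //; rewrite notin_setE => np /=.
by rewrite zD.
Qed.

End Compact.

(** Fubini and the fundamental theorem of calculus: the only form of
    integration by parts that the energy method requires. *)
Lemma integral_partial1 F F1 D :
  (forall p, is_derive p.1 1 (fun t => F (t, p.2)) (F1 p)) ->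
  (forall p, {for p, continuous F1}) ->
  (forall p, ~ unit_square p -> F p = 0) ->
  measurable (D : set (@plane R)) -> (forall p, ~ D p -> F1 p = 0) ->
  integrable2 D F1 /\ integral2 D F1 = 0.
Proof.
move=> dF cF1 F0 mD zD.
have F10 p : ~ unit_square p -> F1 p = 0.
  move=> np; rewrite -(is_derive_derive1 (dF p)).
  apply: is_derive_derive1; apply: is_derive_near (is_derive_fcst 0 p.1).
  have := near_xslice (near_notin_compact (@compact_rectangle R _ _ _ _) np).
  by apply: filterS => t /F0 ->.
split; first exact: compact_supp_integrable2.
rewrite compact_supp_integral2//.
have iT := compact_supp_integrable2T cF1 F10.
rewrite /integral2 /Rintegral.
have E := @integral21_prod_meas1 _ _ _ _ R (@lebesgue_measure R)
  (@lebesgue_measure R) (EFin \o F1) iT.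
rewrite [X in fine X](_ : _ = 0%E)//; apply: (eq_trans (esym E)).
apply: integral0_eq => y _; rewrite /fubini_G /=.
apply: (@integral_lebesgue_derivative (fun t => F (t, y))).
- by move=> t; exact: (dF (t, y)).
- move=> t; apply: (@continuous_comp _ _ _ (fun t => (t, y)) F1); last exact: cF1.
  exact: (@cvg_xslice R (t, y)).
- by move=> t nt; apply: F0 => /rectangleP[].
- by move=> t nt; apply: F10 => /rectangleP[].
Qed.

Lemma integral_partial2 F F1 D :
  (forall p, is_derive p.2 1 (fun t => F (p.1, t)) (F1 p)) ->
  (forall p, {for p, continuous F1}) ->
  (forall p, ~ unit_square p -> F p = 0) ->
  measurable (D : set (@plane R)) -> (forall p, ~ D p -> F1 p = 0) ->
  integrable2 D F1 /\ integral2 D F1 = 0.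
Proof.
move=> dF cF1 F0 mD zD.
have F10 p : ~ unit_square p -> F1 p = 0.
  move=> np; rewrite -(is_derive_derive1 (dF p)).
  apply: is_derive_derive1; apply: is_derive_near (is_derive_fcst 0 p.2).
  have := near_yslice (near_notin_compact (@compact_rectangle R _ _ _ _) np).
  by apply: filterS => t /F0 ->.
split; first exact: compact_supp_integrable2.
rewrite compact_supp_integral2//.
have iT := compact_supp_integrable2T cF1 F10.
rewrite /integral2 /Rintegral.
have E := @integral12_prod_meas1 _ _ _ _ R (@lebesgue_measure R)
  (@lebesgue_measure R) (EFin \o F1) iT.
rewrite [X in fine X](_ : _ = 0%E)//; apply: (eq_trans (esym E)).
apply: integral0_eq => x _; rewrite /fubini_F /=.
apply: (@integral_lebesgue_derivative (fun t => F (x, t))).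
- by move=> t; exact: (dF (x, t)).
- move=> t; apply: (@continuous_comp _ _ _ (fun t => (x, t)) F1); last exact: cF1.
  exact: (@cvg_yslice R (x, t)).
- by move=> t nt; apply: F0 => /rectangleP[].
- by move=> t nt; apply: F10 => /rectangleP[].
Qed.

End Divergence.

(** * Smooth bump functions *)

Section Flat.
Context {R : realType}.

Lemma is_derive0_quadratic (f : R -> R) (t C d : R) : 0 < d ->
  (forall h, `|h| < d -> `|f (t + h) - f t| <= C * h ^+ 2) ->
  is_derive t 1 f 0.
Proof.
move=> d0 H.
have C0 : 0 <= C.
  have := H (d / 2); rewrite gtr0_norm; last lra.
  move=> /(_ ltac:(lra)) /(le_trans (normr_ge0 _)).
  by rewrite pmulr_lge0// exprn_gt0//; lra.
have L : (h^-1 *: (f (h *: 1 + t) - f t)) @[h --> 0^'] --> (0 : R).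
  apply/cvgrPdist_lt => e e0; near=> h.
  have hd : `|h| < d.
    by near: h; exact: dnbhs0_lt.
  have h0 : h != 0 by near: h; exact: nbhs_dnbhs_neq.
  have he : `|h| < e / (C + 1).
    by near: h; apply: dnbhs0_lt; rewrite divr_gt0//; lra.
  rewrite sub0r normrN /GRing.scale/= mulr1 normrM normfV [h + t]addrC.
  rewrite mulrC ltr_pdivrMr ?normr_gt0//.
  have := H h hd => /le_lt_trans; apply.
  rewrite -(real_normK (num_real h)) expr2 mulrA ltr_pM2r ?normr_gt0//.
  move: he; rewrite ltr_pdivlMr; last lra.
  by have := normr_ge0 h; nra.
by apply: DeriveDef; [apply/cvg_ex; exists 0|exact/cvg_lim].
Unshelve. all: by end_near. Qed.

(** The family is closed under differentiation, and all its members vanish to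
    infinite order at 0. *)
Definition flat (k : nat) (t : R) : R :=
  if 0 < t then t^-1 ^+ k * expR (- t^-1) else 0.

Lemma flat_pos k t : 0 < t -> flat k t = t^-1 ^+ k * expR (- t^-1).
Proof. by rewrite /flat => ->. Qed.

Lemma flat_neg k t : t <= 0 -> flat k t = 0.
Proof. by rewrite /flat leNgt => /negbTE ->. Qed.

Lemma flat_ge0 k t : 0 <= flat k t.
Proof.
rewrite /flat; case: ifP => // t0.
by rewrite mulr_ge0 ?expR_ge0// exprn_ge0// invr_ge0 ltW.
Qed.

Lemma flat_gt0 k t : 0 < t -> 0 < flat k t.
Proof. by move=> t0; rewrite flat_pos// mulr_gt0 ?expR_gt0// exprn_gt0// invr_gt0. Qed.

(** From [1 + s^(k+2)/(k+2)! <= exp s] at [s = 1/h]. *)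
Lemma flat_quadratic k h : flat k h <= (k.+2)`!%:R * h ^+ 2.
Proof.
have [h0|h0] := leP h 0.
  by rewrite flat_neg// mulr_ge0 ?sqr_ge0.
rewrite flat_pos// expRN ler_pdivrMr ?expR_gt0//.
have s0 : 0 < h^-1 by rewrite invr_gt0.
have f0 : 0 < (k.+2)`!%:R :> R by rewrite ltr0n fact_gt0.
have := @expR_ge1Dxn R (h^-1) k.+1 (ltW s0).
set E := expR _; set f := _%:R => HE.
have {}HE : h^-1 ^+ k.+2 <= f * E.
  by rewrite mulrC -ler_pdivrMr//; lra.
have -> : h^-1 ^+ k = h ^+ 2 * h^-1 ^+ k.+2.
  by rewrite !exprS expr0 mulr1 !mulrA -[h * h * h^-1]mulrA divff ?mulr1 ?divff ?mul1r//; lra.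
rewrite (_ : f * h ^+ 2 * E = h ^+ 2 * (f * E)); last by ring.
by rewrite ler_pM2l// exprn_gt0.
Qed.

Lemma is_derive_flat k (t : R) :
  is_derive t 1 (flat k) (flat k.+2 t - k%:R * flat k.+1 t).
Proof.
have [t0|t0|->] := ltgtP t 0.
- rewrite !flat_neg ?(ltW t0)// mulr0 subr0.
  apply: is_derive_near (is_derive_fcst 0 t).
  have : t \in `]t - 1, 0[ by rewrite in_itv/=; lra.
  move=> /near_in_itvoo; apply: filterS => s; rewrite in_itv/= => s0.
  by rewrite flat_neg//; lra.
- have dV : is_derive t 1 (fun x => x^-1) (- 1 / t ^+ 2).
    exact: (@is_derive_fV _ (fun x => x) t 1 (lt0r_neq0 t0) (is_derive_fid t)).
  have dE : is_derive t 1 (fun x => expR (- x^-1)) (expR (- t^-1) * - (- 1 / t ^+ 2)).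
    by apply: (is_derive_fcomp (is_derive_fN dV)).
  have dX : is_derive t 1 (fun x => x^-1 ^+ k) (k%:R * t^-1 ^+ k.-1 * (- 1 / t ^+ 2)).
    have dXk : is_derive (t^-1) 1 (fun x : R => x ^+ k) (k%:R * t^-1 ^+ k.-1).
      have h := is_deriveX k (is_derive_id (t^-1) (1 : R)).
      by apply: (is_derive_ext h) => [x|]; rewrite ?exprfctE// /GRing.scale/= mulr1.
    exact: (is_derive_fcomp dV dXk).
  apply: (@is_derive_near _ (fun x => x^-1 ^+ k * expR (- x^-1))).
    have : t \in `]0, t + 1[ by rewrite in_itv/=; lra.
    move=> /near_in_itvoo; apply: filterS => s; rewrite in_itv/= => s0.
    by rewrite flat_pos//; lra.
  apply: (is_derive_ext (is_derive_fM dX dE)) => //.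
  rewrite !flat_pos// -exprVn; case: (k) => [|m] /=; first by rewrite !mul0r expr0; ring.
  by rewrite !exprS; ring.
- rewrite !flat_neg// mulr0 subr0.
  apply: (@is_derive0_quadratic _ _ (k.+2)`!%:R 1) => // h _.
  by rewrite add0r (flat_neg k (lexx 0)) subr0 ger0_norm ?flat_ge0// flat_quadratic.
Qed.

End Flat.

Section Elementary.
Context {R : realType}.
Implicit Types (f g F : R * R -> R) (D U : set (R * R)) (p q c : R * R).

(** An algebra of smooth functions that is visibly stable under both partial
    derivatives: smoothness of all its members follows by one induction. *)
Inductive elementary : (R * R -> R) -> Prop :=
| el_cst (k : R) : elementary (fun _ => k)
| el_fst : elementary (fun p => p.1)
| el_snd : elementary (fun p => p.2)
| el_flat1 k (a b : R) : elementary (fun p => flat k (a * p.1 + b))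
| el_flat2 k (a b : R) : elementary (fun p => flat k (a * p.2 + b))
| el_add f g : elementary f -> elementary g -> elementary (fun p => f p + g p)
| el_mul f g : elementary f -> elementary g -> elementary (fun p => f p * g p).

Lemma elementary_sub f g : elementary f -> elementary g ->
  elementary (fun p => f p - g p).
Proof.
move=> ef eg; have := el_add ef (el_mul (el_cst (-1)) eg).
by congr elementary; apply/funext => p; rewrite mulN1r.
Qed.

Lemma elementary_partials f : elementary f -> exists f1 f2,
  [/\ elementary f1, elementary f2,
      forall p, is_derive p.1 1 (fun t => f (t, p.2)) (f1 p) &
      forall p, is_derive p.2 1 (fun t => f (p.1, t)) (f2 p)].
Proof.
elim=> {f}.
- move=> k; exists (fun=> 0), (fun=> 0); split; try exact: el_cst;
    by move=> p; exact: is_derive_fcst.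
- exists (fun=> 1), (fun=> 0); split; try exact: el_cst; move=> p /=.
    exact: is_derive_fid.
  exact: is_derive_fcst.
- exists (fun=> 0), (fun=> 1); split; try exact: el_cst; move=> p /=.
    exact: is_derive_fcst.
  exact: is_derive_fid.
- move=> k a b.
  exists (fun p => (flat k.+2 (a * p.1 + b) - k%:R * flat k.+1 (a * p.1 + b)) * a), (fun=> 0).
  split; try exact: el_cst; [|move=> p /=..].
  + apply: el_mul (el_cst a); apply: elementary_sub; first exact: el_flat1.
    by apply: el_mul (el_cst _) _; exact: el_flat1.
  + exact: (is_derive_fcomp (is_derive_faff a b p.1) (is_derive_flat k _)).
  + exact: is_derive_fcst.
- move=> k a b.
  exists (fun=> 0), (fun p => (flat k.+2 (a * p.2 + b) - k%:R * flat k.+1 (a * p.2 + b)) * a).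
  split; try exact: el_cst; [|move=> p /=..].
  + apply: el_mul (el_cst a); apply: elementary_sub; first exact: el_flat2.
    by apply: el_mul (el_cst _) _; exact: el_flat2.
  + exact: is_derive_fcst.
  + exact: (is_derive_fcomp (is_derive_faff a b p.2) (is_derive_flat k _)).
- move=> f g ef [f1 [f2 [ef1 ef2 df1 df2]]] eg [g1 [g2 [eg1 eg2 dg1 dg2]]].
  exists (fun p => f1 p + g1 p), (fun p => f2 p + g2 p); split.
  + exact: el_add.
  + exact: el_add.
  + by move=> p; exact: is_derive_fD.
  + by move=> p; exact: is_derive_fD.
- move=> f g ef [f1 [f2 [ef1 ef2 df1 df2]]] eg [g1 [g2 [eg1 eg2 dg1 dg2]]].
  exists (fun p => f1 p * g p + f p * g1 p), (fun p => f2 p * g p + f p * g2 p); split.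
  + by apply: el_add; exact: el_mul.
  + by apply: el_add; exact: el_mul.
  + by move=> [x y]; exact: (is_derive_fM (df1 (x, y)) (dg1 (x, y))).
  + by move=> [x y]; exact: (is_derive_fM (df2 (x, y)) (dg2 (x, y))).
Qed.

Lemma flat_continuous k : continuous (@flat R k).
Proof. by move=> t; exact: is_derive_continuous (is_derive_flat k t). Qed.

Lemma elementary_continuous f : elementary f -> forall p, {for p, continuous f}.
Proof.
elim=> {f}.
- by move=> k p; exact: cvg_cst.
- exact: continuous_fst.
- exact: continuous_snd.
- move=> k a b p; apply: (@continuous_comp _ _ _ (fun q : R * R => a * q.1 + b) (flat k)).
    by apply: cvgD; [apply: cvgM; [exact: cvg_cst|exact: continuous_fst]|exact: cvg_cst].
  exact: flat_continuous.
- move=> k a b p; apply: (@continuous_comp _ _ _ (fun q : R * R => a * q.2 + b) (flat k)).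
    by apply: cvgD; [apply: cvgM; [exact: cvg_cst|exact: continuous_snd]|exact: cvg_cst].
  exact: flat_continuous.
- by move=> f g _ cf _ cg p; apply: cvgD; [exact: cf|exact: cg].
- by move=> f g _ cf _ cg p; apply: cvgM; [exact: cf|exact: cg].
Qed.

Lemma elementary_smooth f : elementary f -> smooth_on setT f.
Proof.
move=> ef k; elim: k f ef => [|k IH] f ef; split => //.
- by move=> p _; exact: elementary_continuous.
- by move=> p _; exact: elementary_continuous.
have [f1 [f2 [ef1 ef2 df1 df2]]] := elementary_partials ef.
have -> : dx f = f1 by apply/funext => p; exact: is_derive_derive1.
have -> : dy f = f2 by apply/funext => p; exact: is_derive_derive1.
split; [move=> p _|move=> p _|exact: IH|exact: IH].
  by have [] := df1 p.
by have [] := df2 p.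
Qed.

Definition bump c (d : R) : R * R -> R := fun p =>
  flat 0 (1 * p.1 + (d - c.1)) * flat 0 (-1 * p.1 + (d + c.1)) *
  (flat 0 (1 * p.2 + (d - c.2)) * flat 0 (-1 * p.2 + (d + c.2))).

Lemma elementary_bump c d : elementary (bump c d).
Proof. by apply: el_mul; apply: el_mul; (exact: el_flat1 || exact: el_flat2). Qed.

Lemma bump_ge0 c d p : 0 <= bump c d p.
Proof. by rewrite !mulr_ge0 ?flat_ge0. Qed.

Lemma bump_gt0 c d p : `|p.1 - c.1| < d -> `|p.2 - c.2| < d -> 0 < bump c d p.
Proof.
by rewrite !ltr_norml => ? ?; rewrite !mulr_gt0// flat_gt0//; lra.
Qed.

Lemma bump_eq0 c d p :
  ~ rectangle (c.1 - d) (c.1 + d) (c.2 - d) (c.2 + d) p -> bump c d p = 0.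
Proof.
move=> np; rewrite /bump.
have [h|h1] := leP (1 * p.1 + (d - c.1)) 0; first by rewrite (flat_neg 0 h) !mul0r.
have [h|h2] := leP (-1 * p.1 + (d + c.1)) 0; first by rewrite (flat_neg 0 h) mulr0 !mul0r.
have [h|h3] := leP (1 * p.2 + (d - c.2)) 0; first by rewrite (flat_neg 0 h) !mul0r mulr0.
have [h|h4] := leP (-1 * p.2 + (d + c.2)) 0; first by rewrite (flat_neg 0 h) !mulr0.
by exfalso; apply: np; apply/rectangleP; split; lra.
Qed.

(** Compactness as an induction principle over finite unions, which spares the
    bookkeeping of finite subcovers. *)
Lemma compact_induction (T : topologicalType) (P : set T -> Prop) (K : set T) :
  compact K -> P set0 -> (forall A B, P A -> P B -> P (A `|` B)) ->
  (forall x, K x -> exists2 N, nbhs x N & P N) ->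
  exists2 B, P B & K `<=` B.
Proof.
move=> /compact_near_coveringP cK P0 PU PN.
pose F : set_system (set T) := [set X |
  exists2 B, P B & forall C, P C -> B `<=` C -> X C].
have FF : Filter F.
  split; first by exists set0.
    move=> X Y [B PB BX] [C PC CY]; exists (B `|` C); first exact: PU.
    by move=> E PE BCE; split; [apply: BX|apply: CY] => // x ?; apply: BCE; [left|right].
  by move=> X Y XY [B PB BX]; exists B => // C PC BC; apply/XY/BX.
have [x Kx|B PB BK] := cK _ F (fun C x => C x) FF.
  have [N xN PN'] := PN x Kx.
  exists (N, [set C | N `<=` C]) => /=; first by split => //; exists N.
  by move=> [y C] [/= Ny NC]; exact: NC.
by exists B => //; exact: BK.
Qed.

Definition open_box c (d : R) : set (R * R) :=
  [set p | `|p.1 - c.1| < d /\ `|p.2 - c.2| < d].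

Lemma open_open_box c d : open (open_box c d).
Proof.
have -> : open_box c d = ball c.1 d `*` ball c.2 d.
  by apply/seteqP; split => p [] /=; rewrite /ball/= => h1 h2; split; rewrite distrC.
rewrite openE => p [p1 p2]; exists (ball c.1 d, ball c.2 d) => //=; split.
  exact: (open_nbhs_nbhs (conj (ball_open _ _) p1)).
exact: (open_nbhs_nbhs (conj (ball_open _ _) p2)).
Qed.

(** A finite sum of bumps; it only has to be positive on [S], not constant. *)
Lemma exists_bump D (S : set (R * R)) : open D -> compact S -> S `<=` D ->
  exists s, [/\ elementary s, forall p, 0 <= s p, forall p, S p -> 0 < s p &
    exists K, [/\ compact K, K `<=` D & forall p, ~ K p -> s p = 0]].
Proof.
move=> oD cS SD.
pose box c (d : R) := rectangle (c.1 - d) (c.1 + d) (c.2 - d) (c.2 + d).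
pose good B := exists s, [/\ elementary s, forall p, 0 <= s p, forall p, B p -> 0 < s p &
    exists K, [/\ compact K, K `<=` D & forall p, ~ K p -> s p = 0]].
have [||p Sp|B [s [es s0 sB sK]] SB] := @compact_induction _ good S cS.
- exists (fun=> 0); split => //; first exact: el_cst.
  by exists set0; split => //; exact: compact0.
- move=> A B [s [es s0 sA [K [cK KD Ks]]]] [t [et t0 tB [L [cL LD Lt]]]].
  exists (fun p => s p + t p); split.
  + exact: el_add.
  + by move=> p; rewrite addr_ge0.
  + by move=> p [/sA|/tB] ?; [exact: ltr_wpDr|exact: ltr_wpDl].
  + exists (K `|` L); split; [exact: compactU|by move=> p [/KD|/LD]|].
    move=> p np; rewrite Ks ?Lt ?addr0// => ?; apply: np; by [left|right].
- have [d d0 dD] := open_rectangle oD (SD p Sp).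
  exists (open_box p d).
    by apply: open_nbhs_nbhs; split; [exact: open_open_box|split; rewrite subrr normr0].
  exists (bump p d); split.
  + exact: elementary_bump.
  + exact: bump_ge0.
  + by move=> q [? ?]; exact: bump_gt0.
  + exists (box p d); split => //; first exact: compact_rectangle.
    by move=> q; exact: bump_eq0.
by exists s; split => // p /SB; exact: sB.
Qed.

End Elementary.

(** * Approximation in the C^1 norm *)

Section Bernstein.
Context {R : realType}.
Implicit Types (f F H : R * R -> R) (p q : R * R) (h g : nat -> R).

(** [bern n h x] is the Bernstein sum of the values [h 0, ..., h n], that is
    the mean of [h] at a binomial variable with parameters [n] and [x];
    conditioning on one trial gives a recursion without binomial
    coefficients. *)
Fixpoint bern n h (x : R) : R :=
  if n is m.+1 then (1 - x) * bern m h x + x * bern m (fun i => h i.+1) x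
  else h 0%N.

Lemma bernD n h g x : bern n (fun i => h i + g i) x = bern n h x + bern n g x.
Proof. by elim: n h g => [//|n IH] h g /=; rewrite !IH; ring. Qed.

Lemma bernZ n (k : R) h x : bern n (fun i => k * h i) x = k * bern n h x.
Proof. by elim: n h => [//|n IH] h /=; rewrite !IH; ring. Qed.

Lemma bernB n h g x : bern n (fun i => h i - g i) x = bern n h x - bern n g x.
Proof. by elim: n h g => [//|n IH] h g /=; rewrite !IH; ring. Qed.

Lemma bern_cst n (k : R) x : bern n (fun _ => k) x = k.
Proof. by elim: n => [//|n IH] /=; rewrite !IH; ring. Qed.

Lemma le_bern n h g x : 0 <= x <= 1 -> (forall i, (i <= n)%N -> h i <= g i) ->
  bern n h x <= bern n g x.
Proof.
move=> x01; elim: n h g => [|n IH] h g hg /=; first exact: hg.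
apply: lerD; apply: ler_wpM2l; [lra| |lra|]; apply: IH => i iN; apply: hg => //.
exact: leqW.
Qed.

(** Bias and variance of the binomial distribution. *)
Lemma bern_variance n (y x : R) :
  bern n (fun i => (i%:R - y) ^+ 2) x = n%:R * (x * (1 - x)) + (n%:R * x - y) ^+ 2.
Proof.
elim: n y => [|n IH] y /=; first by ring.
have -> : (fun i => (i.+1%:R - y) ^+ 2) = (fun i => (i%:R - (y - 1)) ^+ 2) :> (nat -> R).
  by apply/funext => i; rewrite -natr1; ring.
by rewrite !IH -natr1; ring.
Qed.

Lemma is_derive_bern_param n (h h' : nat -> R -> R) (x t : R) :
  (forall i, is_derive t 1 (h i) (h' i t)) ->
  is_derive t 1 (fun s => bern n (fun i => h i s) x) (bern n (fun i => h' i t) x).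
Proof.
elim: n h h' => [|n IH] h h' dh /=; first exact: dh.
exact: (is_derive_fD (is_derive_fZ (1 - x) (IH h h' dh)) (is_derive_fZ x
  (IH (fun i => h i.+1) (fun i => h' i.+1) (fun i => dh i.+1)))).
Qed.

(** Differentiation in the parameter is a forward difference of the values. *)
Lemma is_derive_bern n h (x : R) :
  is_derive x 1 (bern n.+1 h) (n.+1%:R * bern n (fun i => h i.+1 - h i) x).
Proof.
elim: n h => [|n IH] h.
  have := is_derive_fD (is_derive_fM (is_derive_fB (is_derive_fcst 1 x) (is_derive_fid x)) (is_derive_fcst (h 0%N) x))
     (is_derive_fM (is_derive_fid x) (is_derive_fcst (h 1%N) x)).
  by move=> /is_derive_ext; apply => //=; ring.
have := is_derive_fD (is_derive_fM (is_derive_fB (is_derive_fcst 1 x) (is_derive_fid x)) (IH h))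
     (is_derive_fM (is_derive_fid x) (IH (fun i => h i.+1))).
move=> /is_derive_ext; apply => //.
have -> : bern n.+1 (fun i => h i.+1 - h i) x =
   (1 - x) * bern n (fun i => h i.+1 - h i) x + x * bern n (fun i => h i.+2 - h i.+1) x by [].
have E : bern n.+1 (fun i => h i.+1) x - bern n.+1 h x = bern n.+1 (fun i => h i.+1 - h i) x.
  by rewrite bernB.
have E2 : bern n.+1 (fun i => h i.+1) x = bern n.+1 h x + ((1 - x) * bern n (fun i => h i.+1 - h i) x + x * bern n (fun i => h i.+2 - h i.+1) x).
  by rewrite -[LHS](subrK (bern n.+1 h x)) E addrC.
by rewrite E2 -(natr1 n.+1); ring.
Qed.

Lemma elementary_bern n (h : nat -> R * R -> R) (l : R * R -> R) :
  (forall i, elementary (h i)) -> elementary l ->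
  elementary (fun p => bern n (fun i => h i p) (l p)).
Proof.
elim: n h => [|n IH] h eh el /=; first exact: eh.
apply: el_add; apply: el_mul => //.
- by apply: elementary_sub => //; exact: el_cst.
- exact: IH.
- exact: (IH (fun i => h i.+1)).
Qed.

(** Uniform continuity in the form that averages well against a variance. *)
Lemma uniform_modulus F (e : R) : (forall p, {for p, continuous F}) -> 0 < e ->
  exists2 C, 0 <= C & forall p q, unit_square p -> unit_square q ->
    `|F q - F p| <= e + C * ((q.1 - p.1) ^+ 2 + (q.2 - p.2) ^+ 2).
Proof.
move=> cF e0.
have [M M0 FM] := @continuous_bounded_rectangle _ F (-1) 1 (-1) 1 cF.
pose good B := exists2 C, 0 <= C & forall p q, B p -> unit_square p -> unit_square q ->
    `|F q - F p| <= e + C * ((q.1 - p.1) ^+ 2 + (q.2 - p.2) ^+ 2).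
have [||p0 _|B [C C0 BC] SB] := @compact_induction _ good _ (@compact_rectangle R (-1) 1 (-1) 1).
- by exists 0.
- move=> A B [C C0 CA] [C' C'0 CB]; exists (C + C'); first exact: addr_ge0.
  move=> p q ABp Sp Sq.
  have s0 : 0 <= (q.1 - p.1) ^+ 2 + (q.2 - p.2) ^+ 2 by rewrite addr_ge0 ?sqr_ge0.
  case: ABp => [/CA|/CB] /(_ q Sp Sq) /le_trans; apply; rewrite lerD2l.
    by rewrite ler_wpM2r// lerDl.
  by rewrite ler_wpM2r// lerDr.
- have [d d0 Hd] := continuous2_ball (cF p0) (e := e / 2) ltac:(lra).
  exists (open_box p0 (d / 2)).
    apply: open_nbhs_nbhs; split; first exact: open_open_box.
    by split; rewrite subrr normr0; lra.
  exists (2 * M / (d / 2) ^+ 2); first by rewrite divr_ge0 ?sqr_ge0//; lra.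
  move=> p q [bp1 bp2] Sp Sq.
  have Fp : `|F p - F p0| < e / 2 by apply: Hd; lra.
  have s0 : 0 <= (q.1 - p.1) ^+ 2 + (q.2 - p.2) ^+ 2 by rewrite addr_ge0 ?sqr_ge0.
  have d20 : 0 < (d / 2) ^+ 2 by rewrite exprn_gt0//; lra.
  have [[c1 c2]|far] := pselect (`|q.1 - p0.1| < d /\ `|q.2 - p0.2| < d).
    have Fq := Hd q c1 c2.
    have : `|F q - F p| <= e.
      by move: Fp Fq; rewrite !ltr_norml ler_norml; lra.
    move=> /le_trans; apply; rewrite lerDl mulr_ge0// divr_ge0//; lra.
  have {}far : (d / 2) ^+ 2 <= (q.1 - p.1) ^+ 2 + (q.2 - p.2) ^+ 2.
    have sq (x : R) : d / 2 <= `|x| -> (d / 2) ^+ 2 <= x ^+ 2.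
      by move=> dx; rewrite -[x ^+ 2]real_normK ?num_real// lerXn2r// nnegrE; lra.
    have tri (x y z : R) : `|x - y| < d / 2 -> d <= `|z - y| -> d / 2 <= `|z - x|.
      by move=> h1 h2; have := ler_normD (z - x) (x - y); rewrite addrA subrK; lra.
    have [h1|h1] := ltP `|q.1 - p0.1| d; last first.
      have := sq _ (tri _ _ _ bp1 h1); have := sqr_ge0 (q.2 - p.2); lra.
    have [h2|h2] := ltP `|q.2 - p0.2| d; first by exfalso; apply: far.
    have := sq _ (tri _ _ _ bp2 h2); have := sqr_ge0 (q.1 - p.1); lra.
  have : `|F q - F p| <= 2 * M.
    have := FM p Sp; have := FM q Sq; rewrite !ler_norml; lra.
  move=> /le_trans; apply.
  apply: (@le_trans _ _ (2 * M / (d / 2) ^+ 2 * (d / 2) ^+ 2)).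
    by rewrite divfK// lt0r_neq0.
  apply: le_trans (_ : 2 * M / (d / 2) ^+ 2 * ((q.1 - p.1) ^+ 2 + (q.2 - p.2) ^+ 2) <= _).
    by rewrite ler_wpM2l// divr_ge0 ?sqr_ge0//; lra.
  by rewrite lerDr ltW.
by exists C => // p q Sp Sq; apply: BC => //; exact: SB.
Qed.

End Bernstein.

Section BernsteinC1.
Context {R : realType}.
Implicit Types (f F H : R * R -> R) (p q : R * R) (h g : nat -> R).

Definition node (N i : nat) : R := 2 * i%:R / N%:R - 1.

Let half (x : R) : R := 1 / 2 * x + 1 / 2.

Lemma bern_node_variance m n (x : R) : (n <= m)%N -> (m <= n.+1)%N -> -1 <= x <= 1 ->
  bern m (fun i => (node n.+1 i - x) ^+ 2) (half x) <= 8 / n.+1%:R.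
Proof.
move=> nm mn x1.
have N0 : 0 < n.+1%:R :> R by rewrite ltr0n.
have N1 : 1 <= n.+1%:R :> R by rewrite ler1n.
set N := n.+1%:R in N0 N1 *.
have -> : (fun i => (node n.+1 i - x) ^+ 2) =
    (fun i => 4 / N ^+ 2 * (i%:R - N * half x) ^+ 2) :> (nat -> R).
  by apply/funext => i; rewrite /node -/N /half; field; lra.
rewrite bernZ bern_variance.
have mN : m%:R <= N by rewrite ler_nat.
have Nm : N <= m%:R + 1 by rewrite natr1 ler_nat.
have h1 : 0 <= half x <= 1 by rewrite /half; lra.
have m0 : 0 <= m%:R :> R by rewrite ler0n.
set t := half x in h1 *.
have b1 : m%:R * (t * (1 - t)) <= N by nra.
have b2 : (m%:R * t - N * t) ^+ 2 <= N.
  have -> : (m%:R * t - N * t) ^+ 2 = (N - m%:R) ^+ 2 * t ^+ 2 by ring.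
  have : (N - m%:R) ^+ 2 <= 1 by nra.
  have : t ^+ 2 <= 1 by nra.
  by have := sqr_ge0 t; have := sqr_ge0 (N - m%:R); nra.
apply: (@le_trans _ _ (4 / N ^+ 2 * (2 * N))).
  by apply: ler_wpM2l; [rewrite divr_ge0 ?sqr_ge0//|lra].
by rewrite le_eqVlt; apply/orP; left; apply/eqP; field; lra.
Qed.

(** A two-variable Bernstein mean of values close to [c] near [p] is close to
    [c]. The degrees [m], [k] may be [n] or [n.+1] because differentiating
    lowers one of them; the slack [8 / n.+1] leaves room to move a node by one
    step. *)
Lemma bern2_close n m k (H : nat -> nat -> R) (c e C : R) p :
  (n <= m)%N -> (m <= n.+1)%N -> (n <= k)%N -> (k <= n.+1)%N ->
  unit_square p -> 0 <= C ->
  (forall i j, (i <= m)%N -> (j <= k)%N -> `|H i j - c| <= e + C *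
     (2 * (node n.+1 i - p.1) ^+ 2 + 2 * (node n.+1 j - p.2) ^+ 2 + 8 / n.+1%:R)) ->
  `|bern m (fun i => bern k (fun j => H i j) (half p.2)) (half p.1) - c|
    <= e + C * (40 / n.+1%:R).
Proof.
move=> nm mn nk kn /rectangleP[p1 p2] C0 HH.
set N := n.+1%:R in HH *.
have hp1 : 0 <= half p.1 <= 1 by rewrite /half; lra.
have hp2 : 0 <= half p.2 <= 1 by rewrite /half; lra.
set L := bern m _ _.
pose E i j := e + C * (2 * (node n.+1 i - p.1) ^+ 2 + 2 * (node n.+1 j - p.2) ^+ 2 + 8 / N).
have LE : bern m (fun i => bern k (fun j => E i j) (half p.2)) (half p.1) <= e + C * (40 / N).
  have -> : (fun i => bern k (fun j => E i j) (half p.2)) = fun i =>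
    (e + C * (2 * bern k (fun j => (node n.+1 j - p.2) ^+ 2) (half p.2) + 8 / N))
     + C * (2 * (node n.+1 i - p.1) ^+ 2).
    apply/funext => i; rewrite /E bernD bern_cst bernZ !bernD !bern_cst bernZ; ring.
  rewrite bernD bern_cst !bernZ.
  have := bern_node_variance nm mn p1; have := bern_node_variance nk kn p2.
  rewrite -/N; set a := bern _ _ _; set b := bern _ _ _ => ka kb.
  have ab : 2 * a + 8 / N + 2 * b <= 40 / N.
    have aux (x y i : R) : x <= 8 * i -> y <= 8 * i -> 2 * y + 8 * i + 2 * x <= 40 * i by lra.
    exact: aux kb ka.
  rewrite -addrA lerD2l -mulrDr ler_wpM2l//.
have up : L <= bern m (fun i => bern k (fun j => c + E i j) (half p.2)) (half p.1).
  apply: le_bern => // i im; apply: le_bern => // j jk.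
  by have := HH i j im jk; rewrite ler_norml -/(E i j); lra.
have lo : bern m (fun i => bern k (fun j => c - E i j) (half p.2)) (half p.1) <= L.
  apply: le_bern => // i im; apply: le_bern => // j jk.
  by have := HH i j im jk; rewrite ler_norml -/(E i j); lra.
move: up lo.
have -> : (fun i => bern k (fun j => c + E i j) (half p.2)) =
  fun i => c + bern k (fun j => E i j) (half p.2).
  by apply/funext => i; rewrite bernD bern_cst.
have -> : (fun i => bern k (fun j => c - E i j) (half p.2)) =
  fun i => c - bern k (fun j => E i j) (half p.2).
  by apply/funext => i; rewrite bernB bern_cst.
have aux (l d t b : R) : t <= b -> l <= d + t -> d - t <= l -> `|l - d| <= b.
  by rewrite ler_norml; lra.
by rewrite bernD bernB !bern_cst; exact: aux LE.
Qed.

Lemma node_bounds n i : (i <= n.+1)%N -> -1 <= node n.+1 i <= 1.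
Proof.
move=> iN; rewrite /node.
have N0 : 0 < n.+1%:R :> R by rewrite ltr0n.
have : 0 <= (i%:R / n.+1%:R : R) <= 1.
  by rewrite divr_ge0 ?ler0n// ler_pdivrMr// mul1r ler_nat.
by rewrite -mulrA; move: (_ / _) => t; lra.
Qed.

Lemma node_step n i : node n.+1 i.+1 = node n.+1 i + 2 / n.+1%:R.
Proof.
have N0 : n.+1%:R != 0 :> R by rewrite pnatr_eq0.
by rewrite /node -(natr1 i); field.
Qed.

Section Approximate.
Variables (F F1 F2 : R * R -> R).
Hypothesis cF : forall p, {for p, continuous F}.
Hypothesis cF1 : forall p, {for p, continuous F1}.
Hypothesis cF2 : forall p, {for p, continuous F2}.
Hypothesis dF1 : forall p, is_derive p.1 1 (fun t => F (t, p.2)) (F1 p).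
Hypothesis dF2 : forall p, is_derive p.2 1 (fun t => F (p.1, t)) (F2 p).

Let P n p := bern n.+1 (fun i => bern n.+1 (fun j =>
  F (node n.+1 i, node n.+1 j)) (half p.2)) (half p.1).

Let P1 n p := bern n (fun i => bern n.+1 (fun j => n.+1%:R / 2 *
  (F (node n.+1 i.+1, node n.+1 j) - F (node n.+1 i, node n.+1 j))) (half p.2)) (half p.1).

Let P2 n p := bern n.+1 (fun i => bern n (fun j => n.+1%:R / 2 *
  (F (node n.+1 i, node n.+1 j.+1) - F (node n.+1 i, node n.+1 j))) (half p.2)) (half p.1).

Let elementary_half1 : elementary (fun p : R * R => half p.1).
Proof. by apply: el_add (el_cst _); apply: el_mul (el_cst _) _; exact: el_fst. Qed.

Let elementary_half2 : elementary (fun p : R * R => half p.2).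
Proof. by apply: el_add (el_cst _); apply: el_mul (el_cst _) _; exact: el_snd. Qed.

Let elementary_P n : elementary (P n).
Proof.
apply: elementary_bern elementary_half1 => i.
by apply: elementary_bern elementary_half2 => j; exact: el_cst.
Qed.

Let derive_P1 n p : is_derive p.1 1 (fun t => P n (t, p.2)) (P1 n p).
Proof.
have := is_derive_fcomp (is_derive_faff (1 / 2) (1 / 2) p.1) (is_derive_bern n
  (fun i => bern n.+1 (fun j => F (node n.+1 i, node n.+1 j)) (half p.2)) (half p.1)).
move=> /is_derive_ext; apply => //; rewrite /P1.
rewrite mul1r mulrAC -bernZ; congr bern; apply/funext => i.
by rewrite -bernB -bernZ.
Qed.

Let derive_P2 n p : is_derive p.2 1 (fun t => P n (p.1, t)) (P2 n p).
Proof.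
apply: (@is_derive_bern_param R n.+1 (fun i t => bern n.+1 (fun j =>
  F (node n.+1 i, node n.+1 j)) (half t)) (fun i t => bern n (fun j => n.+1%:R / 2 *
  (F (node n.+1 i, node n.+1 j.+1) - F (node n.+1 i, node n.+1 j))) (half t))
  (half p.1) p.2) => i.
have := is_derive_fcomp (is_derive_faff (1 / 2) (1 / 2) p.2) (is_derive_bern n
  (fun j => F (node n.+1 i, node n.+1 j)) (half p.2)).
move=> /is_derive_ext; apply => //.
by rewrite mul1r mulrAC -bernZ.
Qed.

Let step0 n : 0 < 2 / n.+1%:R :> R.
Proof. by rewrite divr_gt0 ?ltr0n. Qed.

Let stepE n : n.+1%:R / 2 * (2 / n.+1%:R) = 1 :> R.
Proof. by field; rewrite nat1r pnatr_eq0. Qed.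

Let step_sq n : (2 / n.+1%:R) ^+ 2 <= 4 / n.+1%:R :> R.
Proof.
have N1 : 1 <= n.+1%:R :> R by rewrite ler1n.
move: (n.+1%:R) N1 => N N1; have N0 : 0 < N by lra.
rewrite -subr_ge0 (_ : _ - _ = 4 * (N - 1) / N ^+ 2); last by field; lra.
by rewrite divr_ge0 ?sqr_ge0//; lra.
Qed.

(* Each difference quotient of [F] between neighbouring nodes is a value of
   the partial derivative, by the mean value theorem. *)
Let quotient1 n i (p : R) : exists2 z, `|z - node n.+1 i| <= 2 / n.+1%:R /\
    node n.+1 i <= z <= node n.+1 i.+1 &
  n.+1%:R / 2 * (F (node n.+1 i.+1, p) - F (node n.+1 i, p)) = F1 (z, p).
Proof.
have ab : node n.+1 i < node n.+1 i.+1 by rewrite node_step ltrDl.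
have [x _|x _|z zab E] := @mean_value _ (fun t => F (t, p)) _ _ ab.
- by have [] := dF1 (x, p).
- exact: (is_derive_continuous (dF1 (x, p))).
exists z.
  by move: zab (step0 n); rewrite node_step ler_norml; move: (2 / n.+1%:R) => d *; split; lra.
rewrite E node_step addrAC subrr add0r mulrCA stepE mulr1.
exact: (is_derive_derive1 (dF1 (z, p))).
Qed.

Let quotient2 n i (p : R) : exists2 z, `|z - node n.+1 i| <= 2 / n.+1%:R /\
    node n.+1 i <= z <= node n.+1 i.+1 &
  n.+1%:R / 2 * (F (p, node n.+1 i.+1) - F (p, node n.+1 i)) = F2 (p, z).
Proof.
have ab : node n.+1 i < node n.+1 i.+1 by rewrite node_step ltrDl.
have [x _|x _|z zab E] := @mean_value _ (fun t => F (p, t)) _ _ ab.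
- by have [] := dF2 (p, x).
- exact: (is_derive_continuous (dF2 (p, x))).
exists z.
  by move: zab (step0 n); rewrite node_step ler_norml; move: (2 / n.+1%:R) => d *; split; lra.
rewrite E node_step addrAC subrr add0r mulrCA stepE mulr1.
exact: (is_derive_derive1 (dF2 (p, z))).
Qed.

Let sq_shift n (z a x : R) : `|z - a| <= 2 / n.+1%:R ->
  (z - x) ^+ 2 <= 2 * (a - x) ^+ 2 + 8 / n.+1%:R.
Proof.
move=> h; have h2 : (z - a) ^+ 2 <= 4 / n.+1%:R.
  apply: le_trans (step_sq n); rewrite -[leLHS]real_normK ?num_real//.
  by rewrite lerXn2r// nnegrE ltW.
have := sqr_ge0 (z - a - (a - x)).
have -> : 8 / n.+1%:R = 2 * (4 / n.+1%:R) :> R by rewrite mulrA -natrM.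
by move: (4 / n.+1%:R) h2 => d; nra.
Qed.

(** Derivatives of Bernstein polynomials are Bernstein means of difference
    quotients, hence of nearby values of the derivative. *)
Lemma bernstein_C1 (e : R) : 0 < e -> exists Q Q1 Q2, [/\ elementary Q,
    forall p, is_derive p.1 1 (fun t => Q (t, p.2)) (Q1 p),
    forall p, is_derive p.2 1 (fun t => Q (p.1, t)) (Q2 p) &
    forall p, unit_square p ->
      [/\ `|Q p - F p| <= e, `|Q1 p - F1 p| <= e & `|Q2 p - F2 p| <= e]].
Proof.
move=> e0; have e20 : 0 < e / 2 by lra.
have [C C0 HC] := uniform_modulus cF e20.
have [C1 C10 HC1] := uniform_modulus cF1 e20.
have [C2 C20 HC2] := uniform_modulus cF2 e20.
pose K := C + C1 + C2.
have [n Kn] : exists n : nat, K * 40 / (e / 2) < n.+1%:R.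
  exists (Num.truncn (K * 40 / (e / 2))).
  by rewrite real_truncnS_gt ?num_real.
have N0 : 0 < n.+1%:R :> R by rewrite ltr0n.
have small (D : R) : D <= K -> e / 2 + D * (40 / n.+1%:R) <= e.
  move=> DK; suff : D * (40 / n.+1%:R) <= e / 2 by move: (D * _) => z; lra.
  apply: (@le_trans _ _ (K * (40 / n.+1%:R))).
    by rewrite ler_wpM2r// divr_ge0// ltW.
  rewrite mulrA ler_pdivrMr//; move: Kn; rewrite ltr_pdivrMr// => Kn.
  by rewrite [e / 2 * _]mulrC ltW.
have node_in i : (i <= n.+1)%N -> -1 <= node n.+1 i <= 1 by exact: node_bounds.
exists (P n), (P1 n), (P2 n); split => // p Sp.
split.
- apply: le_trans (small C _); last by rewrite /K; lra.
  apply: bern2_close => // i j iN jN.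
  have Sij : unit_square (node n.+1 i, node n.+1 j) by apply/rectangleP; split; exact: node_in.
  apply: le_trans (HC _ _ Sp Sij) _; rewrite lerD2l ler_wpM2l//=.
  have := sqr_ge0 (node n.+1 i - p.1); have := sqr_ge0 (node n.+1 j - p.2).
  have : 0 <= 8 / n.+1%:R :> R by rewrite divr_ge0// ltW.
  by move: (8 / _) => d; lra.
- apply: le_trans (small C1 _); last by rewrite /K; lra.
  apply: bern2_close => // i j iN jN.
  have [z [zi zz] ->] := quotient1 n i (node n.+1 j).
  have ni := node_in _ (leqW iN); have ni1 : -1 <= node n.+1 i.+1 <= 1 by exact: node_in.
  have Sij : unit_square (z, node n.+1 j).
    by apply/rectangleP; split; [rewrite /=; lra|exact: node_in].
  apply: le_trans (HC1 _ _ Sp Sij) _; rewrite lerD2l ler_wpM2l//=.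
  by have := sq_shift p.1 zi; have := sqr_ge0 (node n.+1 j - p.2); move: (8 / _) => d; lra.
- apply: le_trans (small C2 _); last by rewrite /K; lra.
  apply: bern2_close => // i j iN jN.
  have [z [zi zz] ->] := quotient2 n j (node n.+1 i).
  have ni := node_in _ (leqW jN); have ni1 : -1 <= node n.+1 j.+1 <= 1 by exact: node_in.
  have Sij : unit_square (node n.+1 i, z).
    by apply/rectangleP; split; [exact: node_in|rewrite /=; lra].
  apply: le_trans (HC2 _ _ Sp Sij) _; rewrite lerD2l ler_wpM2l//=.
  by have := sq_shift p.2 zi; have := sqr_ge0 (node n.+1 i - p.1); move: (8 / _) => d; lra.
Qed.

End Approximate.

End BernsteinC1.

(** * The weak equation tested against C^1 functions *)

Section WeakEquation.
Context {R : realType}.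
Implicit Types (f F H : R * R -> R) (p q : R * R).

Definition C1 (w w1 w2 : R * R -> R) : Prop :=
  [/\ forall p, {for p, continuous w}, forall p, {for p, continuous w1},
      forall p, {for p, continuous w2},
      forall p, is_derive p.1 1 (fun t => w (t, p.2)) (w1 p) &
      forall p, is_derive p.2 1 (fun t => w (p.1, t)) (w2 p)].

Lemma elementary_C1 f : elementary f -> exists f1 f2, C1 f f1 f2.
Proof.
move=> ef; have [f1 [f2 [ef1 ef2 df1 df2]]] := elementary_partials ef.
by exists f1, f2; split => //; exact: elementary_continuous.
Qed.

Lemma is_derive_unique (f : R -> R) (t l m : R) :
  is_derive t 1 f l -> is_derive t 1 f m -> l = m.
Proof. by move=> /is_derive_derive1 <- /is_derive_derive1 <-. Qed.

Section Approximation.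
Variables (D S : set (R * R)) (w w1 w2 : R * R -> R).
Hypotheses (oD : open D) (Dsquare : D `<=` unit_square).
Hypotheses (cS : compact S) (SD : S `<=` D).
Hypothesis Cw : C1 w w1 w2.
Hypothesis w0 : forall p, ~ S p -> w p = 0.

Let w1_0 p : ~ S p -> w1 p = 0.
Proof.
move=> nS; have [_ _ _ dw _] := Cw.
apply: is_derive_unique (dw p) _; apply: is_derive_near (is_derive_fcst 0 p.1).
by apply: filterS (near_xslice (near_notin_compact cS nS)) => t /w0 ->.
Qed.

Let w2_0 p : ~ S p -> w2 p = 0.
Proof.
move=> nS; have [_ _ _ _ dw] := Cw.
apply: is_derive_unique (dw p) _; apply: is_derive_near (is_derive_fcst 0 p.2).
by apply: filterS (near_yslice (near_notin_compact cS nS)) => t /w0 ->.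
Qed.

(** Writing [w = s * (w / s)] with a smooth cutoff [s] that is positive on the
    support of [w], and approximating only the second factor, keeps the
    approximants compactly supported. *)
Lemma C1_test_approximation (e : R) : 0 < e -> exists psi psi1 psi2,
  [/\ test_function D psi, C1 psi psi1 psi2 & forall p, D p ->
    [/\ `|psi p - w p| <= e, `|psi1 p - w1 p| <= e & `|psi2 p - w2 p| <= e]].
Proof.
move=> e0; have [s [es s0 sS [K [cK KD Ks]]]] := exists_bump oD cS SD.
have [s1 [s2 [cs cs1 cs2 ds1 ds2]]] := elementary_C1 es.
have [cw cw1 cw2 dw1 dw2] := Cw.
pose f p := w p * (s p)^-1.
pose f1 p := (w1 p * s p - w p * s1 p) * ((s p)^-1 * (s p)^-1).
pose f2 p := (w2 p * s p - w p * s2 p) * ((s p)^-1 * (s p)^-1).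
have nearS p : ~ S p -> \forall q \near p, [/\ w q = 0, w1 q = 0 & w2 q = 0].
  move=> nS; apply: filterS (near_notin_compact cS nS) => q nq.
  by rewrite w0// w1_0// w2_0.
have zero_cont (h : R * R -> R) p : (\forall q \near p, h q = 0) -> {for p, continuous h}.
  move=> h0; change (h @ p --> h p); rewrite (nbhs_singleton h0).
  have E : \forall q \near p, 0 = h q by apply: filterS h0 => q ->.
  exact: cvg_trans (near_eq_cvg E) (cvg_cst _).
have cV p : S p -> {for p, continuous (fun q => (s q)^-1)}.
  by move=> /sS sp; apply: cvgV; [rewrite gt_eqF|exact: cs].
have cf p : {for p, continuous f}.
  have [Sp|nS] := pselect (S p); first by apply: cvgM; [exact: cw|exact: cV].
  by apply: zero_cont; apply: filterS (nearS p nS) => q [wq _ _]; rewrite /f wq mul0r.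
have cf1 p : {for p, continuous f1}.
  have [Sp|nS] := pselect (S p); last first.
    by apply: zero_cont; apply: filterS (nearS p nS) => q [wq wq1 _]; rewrite /f1 wq wq1 !mul0r subrr mul0r.
  apply: cvgM; first by apply: cvgB; apply: cvgM; [exact: cw1|exact: cs|exact: cw|exact: cs1].
  by apply: cvgM; exact: cV.
have cf2 p : {for p, continuous f2}.
  have [Sp|nS] := pselect (S p); last first.
    by apply: zero_cont; apply: filterS (nearS p nS) => q [wq _ wq2]; rewrite /f2 wq wq2 !mul0r subrr mul0r.
  apply: cvgM; first by apply: cvgB; apply: cvgM; [exact: cw2|exact: cs|exact: cw|exact: cs2].
  by apply: cvgM; exact: cV.
have df1 p : is_derive p.1 1 (fun t => f (t, p.2)) (f1 p).
  have [Sp|nS] := pselect (S p); last first.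
    have [wp wp1 _] := nbhs_singleton (nearS p nS).
    rewrite /f1 wp wp1 !mul0r subrr mul0r; apply: is_derive_near (is_derive_fcst 0 p.1).
    by apply: filterS (near_xslice (nearS p nS)) => t [wt _ _]; rewrite /f wt mul0r.
  have := sS p Sp; case: p Sp => x y Sp sp.
  have sn : s (x, y) != 0 by rewrite gt_eqF.
  apply: (is_derive_ext (is_derive_fM (dw1 (x, y)) (is_derive_fV (f := fun t => s (t, y)) sn (ds1 (x, y))))) => //.
  by rewrite /f1 /=; field.
have df2 p : is_derive p.2 1 (fun t => f (p.1, t)) (f2 p).
  have [Sp|nS] := pselect (S p); last first.
    have [wp _ wp2] := nbhs_singleton (nearS p nS).
    rewrite /f2 wp wp2 !mul0r subrr mul0r; apply: is_derive_near (is_derive_fcst 0 p.2).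
    by apply: filterS (near_yslice (nearS p nS)) => t [wt _ _]; rewrite /f wt mul0r.
  have := sS p Sp; case: p Sp => x y Sp sp.
  have sn : s (x, y) != 0 by rewrite gt_eqF.
  apply: (is_derive_ext (is_derive_fM (dw2 (x, y)) (is_derive_fV (f := fun t => s (x, t)) sn (ds2 (x, y))))) => //.
  by rewrite /f2 /=; field.
have wE p : w p = s p * f p.
  have [Sp|nS] := pselect (S p); last by rewrite /f w0// mul0r mulr0.
  by rewrite /f; field; rewrite gt_eqF// sS.
have w1E p : w1 p = s1 p * f p + s p * f1 p.
  have [Sp|nS] := pselect (S p).
    by rewrite /f /f1; field; rewrite gt_eqF// sS.
  by rewrite /f /f1 w0// w1_0// !mul0r subrr !mul0r !mulr0 addr0.
have w2E p : w2 p = s2 p * f p + s p * f2 p.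
  have [Sp|nS] := pselect (S p).
    by rewrite /f /f2; field; rewrite gt_eqF// sS.
  by rewrite /f /f2 w0// w2_0// !mul0r subrr !mul0r !mulr0 addr0.
have [M M0 sM] := continuous_bounded_rectangle (-1) 1 (-1) 1 cs.
have [M1 M10 s1M] := continuous_bounded_rectangle (-1) 1 (-1) 1 cs1.
have [M2 M20 s2M] := continuous_bounded_rectangle (-1) 1 (-1) 1 cs2.
pose d := e / (M + M1 + M2 + 1).
have d0 : 0 < d by rewrite divr_gt0//; lra.
have dE : (M + M1 + M2 + 1) * d = e by rewrite /d; field; lra.
have [Q [Q1 [Q2 [eQ dQ1 dQ2 QF]]]] := bernstein_C1 cf cf1 cf2 df1 df2 d0.
have epsi : elementary (fun p => s p * Q p) by exact: el_mul.
have [psi1 [psi2 Cpsi]] := elementary_C1 epsi.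
exists (fun p => s p * Q p), psi1, psi2; split => //.
  split; first exact: elementary_smooth.
  by exists K; split => // p nK; rewrite Ks// mul0r.
have [_ _ _ dpsi1 dpsi2] := Cpsi.
move=> [x y] Dp; have Sq := Dsquare Dp.
have := QF _ Sq; set p := (x, y) => -[B0 B1 B2].
have E1 : psi1 p = s1 p * Q p + s p * Q1 p.
  exact: is_derive_unique (dpsi1 p) (is_derive_fM (ds1 (x, y)) (dQ1 (x, y))).
have E2 : psi2 p = s2 p * Q p + s p * Q2 p.
  exact: is_derive_unique (dpsi2 p) (is_derive_fM (ds2 (x, y)) (dQ2 (x, y))).
have mulb (a b A : R) : `|a| <= A -> `|b| <= d -> `|a * b| <= A * d.
  by move=> aA bd; rewrite normrM ler_pM.
have N0 := mulb _ _ _ (sM _ Sq) B0.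
have := sM _ Sq; have := s1M _ Sq; have := s2M _ Sq; rewrite -/p => bs2 bs1 bs.
have M1d : 0 <= M1 * d by rewrite mulr_ge0// ltW.
have M2d : 0 <= M2 * d by rewrite mulr_ge0// ltW.
have Md : 0 <= M * d by rewrite mulr_ge0// ltW.
have E : M * d + M1 * d + M2 * d + d = e by rewrite -dE; ring.
split.
- rewrite wE -mulrBr; apply: (le_trans (mulb _ _ _ bs B0)); lra.
- rewrite w1E E1 (_ : _ - _ = s1 p * (Q p - f p) + s p * (Q1 p - f1 p)); last by ring.
  apply: (le_trans (ler_normD _ _)).
  by have := mulb _ _ _ bs1 B0; have := mulb _ _ _ bs B1; lra.
- rewrite w2E E2 (_ : _ - _ = s2 p * (Q p - f p) + s p * (Q2 p - f2 p)); last by ring.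
  apply: (le_trans (ler_normD _ _)).
  by have := mulb _ _ _ bs2 B0; have := mulb _ _ _ bs B2; lra.
Qed.

Hypothesis mD : measurable (D : set (@plane R)).
Hypothesis fD : (leb2 (D : set (@plane R)) < +oo)%E.

Let compact_bounded F : (forall p, {for p, continuous F}) ->
  exists2 M, 0 <= M & forall p, D p -> `|F p| <= M.
Proof.
move=> cF; have [M M0 FM] := continuous_bounded_rectangle (-1) 1 (-1) 1 cF.
by exists M => // p /Dsquare; exact: FM.
Qed.

Lemma continuous_integrable2 F : (forall p, {for p, continuous F}) -> integrable2 D F.
Proof.
move=> cF; have [M M0 FM] := compact_bounded cF.
by apply: (bounded_integrable2 mD fD _ FM); exact: continuous_measurable2.
Qed.

Lemma L2_mul_continuous_integrable2 g F : measurable2 D g ->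
  integrable2 D (fun p => g p ^+ 2) -> (forall p, {for p, continuous F}) ->
  integrable2 D (fun p => g p * F p).
Proof.
move=> mg g2 cF; have [M M0 FM] := compact_bounded cF.
by apply: (bounded_mul_integrable2 mD fD mg _ g2 FM); exact: continuous_measurable2.
Qed.

Variables (g1 g2 : R * R -> R).
Hypotheses (mg1 : measurable2 D g1) (mg2 : measurable2 D g2).
Hypotheses (ig1 : integrable2 D (fun p => g1 p ^+ 2)).
Hypotheses (ig2 : integrable2 D (fun p => g2 p ^+ 2)).
Hypothesis weak : forall psi, test_function D psi ->
  (\int[leb2]_(p in (D : set plane)) (g1 p * dx psi p + g2 p * dy psi p)%:E =
   \int[leb2]_(p in (D : set plane)) (psi p)%:E)%E.

Lemma weak_equation_integrable (v v1 v2 : R * R -> R) : C1 v v1 v2 ->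
  integrable2 D (fun p => g1 p * v1 p + g2 p * v2 p - v p).
Proof.
move=> [cv cv1 cv2 _ _]; apply: integrable2B => //; last exact: continuous_integrable2.
by apply: integrable2D => //; exact: L2_mul_continuous_integrable2.
Qed.

(** C^1 approximation passes to the limit in the weak equation since [g1] and
    [g2] are integrable, [|g| <= 1 + g^2]. *)
Lemma weak_equation_C1 : integral2 D (fun p => g1 p * w1 p + g2 p * w2 p - w p) = 0.
Proof.
pose X p := g1 p * w1 p + g2 p * w2 p - w p.
pose B p := 3 + (g1 p ^+ 2 + g2 p ^+ 2).
have iX : integrable2 D X by exact: weak_equation_integrable.
have iB : integrable2 D B.
  by apply: integrable2D => //; [exact: cst_integrable2|exact: integrable2D].
have B0 : 0 <= integral2 D B.
  by apply: integral2_ge0 => p _; rewrite !addr_ge0// sqr_ge0.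
suff H (e : R) : 0 < e -> `|integral2 D X| <= e * integral2 D B.
  apply/eqP; rewrite -normr_eq0 eq_le normr_ge0 andbT.
  apply/ler_addgt0Pr => e e0; rewrite add0r.
  have := H (e / (integral2 D B + 1)); rewrite divr_gt0//; last lra.
  move=> /(_ erefl) /le_trans; apply.
  by rewrite mulrAC ler_pdivrMr; [rewrite ler_pM2l//; lra|lra].
move=> e0; have [psi [psi1 [psi2 [tpsi Cpsi close]]]] := C1_test_approximation e0.
pose Y p := g1 p * psi1 p + g2 p * psi2 p - psi p.
have iY : integrable2 D Y by exact: weak_equation_integrable.
have [cpsi cpsi1 cpsi2 dpsi1 dpsi2] := Cpsi.
have Y0 : integral2 D Y = 0.
  rewrite /Y integral2B//; last exact: continuous_integrable2.
    have := weak tpsi.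
    have -> : dx psi = psi1 by apply/funext => p; exact: is_derive_derive1.
    have -> : dy psi = psi2 by apply/funext => p; exact: is_derive_derive1.
    by rewrite /integral2 /Rintegral => ->; rewrite subrr.
  by apply: integrable2D => //; exact: L2_mul_continuous_integrable2.
have XY : integral2 D X = integral2 D (fun p => X p - Y p).
  by rewrite (integral2B mD iX iY) -[X in _ = _ - X]/(integral2 D Y) Y0 subr0.
have pointwise p : D p -> `|X p - Y p| <= e * B p.
  move=> Dp; have [c0 c1 c2] := close p Dp.
  rewrite (_ : X p - Y p = g1 p * - (psi1 p - w1 p) + g2 p * - (psi2 p - w2 p)
     + (psi p - w p)); last by rewrite /X /Y; ring.
  apply: (le_trans (ler_normD _ _)).
  have sqb (g c : R) : `|c| <= e -> `|g * - c| <= e * (1 + g ^+ 2).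
    move=> ce; rewrite normrM normrN mulrC ler_pM//.
    by have := sqr_ge0 (`|g| - 1); rewrite -(real_normK (num_real g)); nra.
  have := ler_normD (g1 p * - (psi1 p - w1 p)) (g2 p * - (psi2 p - w2 p)).
  have := sqb (g1 p) _ c1; have := sqb (g2 p) _ c2; rewrite /B; lra.
rewrite XY ler_norml; apply/andP; split.
  rewrite -mulNr -integral2Z//; apply: le_integral2 => //.
  - exact: integrable2Z.
  - exact: integrable2B.
  - by move=> p /pointwise; rewrite ler_norml; lra.
rewrite -integral2Z//; apply: le_integral2 => //.
- exact: integrable2B.
- exact: integrable2Z.
- by move=> p /pointwise; rewrite ler_norml; lra.
Qed.

End Approximation.

End WeakEquation.

(** * The energy estimate *)

Section Truncation.
Context {R : realType}.
Variable d : R.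
Hypothesis dpos : 0 < d.

(** A C^1 substitute for the positive part, within [d] of it. *)
Definition ramp (t : R) : R := if 0 < t then t ^+ 2 / (t + d) else 0.

Definition ramp' (t : R) : R :=
  Num.max 0 t * (Num.max 0 t + 2 * d) / (Num.max 0 t + d) ^+ 2.

Lemma is_derive_ramp (t : R) : is_derive t 1 ramp (ramp' t).
Proof.
have d0 := dpos.
rewrite /ramp'; have [t0|t0|->] := ltgtP t 0.
- rewrite !mul0r.
  apply: is_derive_near (is_derive_fcst 0 t).
  have : t \in `]t - 1, 0[ by rewrite in_itv/=; lra.
  move=> /near_in_itvoo; apply: filterS => s; rewrite in_itv/= => s0.
  by rewrite /ramp ltNge; have -> : s <= 0 by lra.
-
  apply: (@is_derive_near _ (fun x => x * x * (x + d)^-1)).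
    have : t \in `]0, t + 1[ by rewrite in_itv/=; lra.
    move=> /near_in_itvoo; apply: filterS => s; rewrite in_itv/= => s0.
    by rewrite /ramp; have -> : 0 < s by lra.
  have td : t + d != 0 by rewrite gt_eqF// addr_gt0.
  have h := is_derive_fM (is_derive_fM (is_derive_fid t) (is_derive_fid t))
    (is_derive_fV (f := fun x => x + d) td (is_derive_fD (is_derive_fid t) (is_derive_fcst d t))).
  by apply: (is_derive_ext h) => //; field.
- rewrite !mul0r.
  apply: (@is_derive0_quadratic _ _ _ d^-1 1) => // h _.
  rewrite add0r {2}/ramp ltxx subr0 /ramp; case: ifPn => h0.
    have hd : 0 < h + d by rewrite addr_gt0.
    rewrite ger0_norm; last by rewrite divr_ge0 ?sqr_ge0 ?ltW.
    by rewrite mulrC ler_wpM2r ?sqr_ge0// lef_pV2 ?posrE// lerDr ltW.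
  by rewrite normr0 mulr_ge0 ?sqr_ge0// invr_ge0 ltW.
Qed.

Lemma continuous_ramp' : continuous ramp'.
Proof.
have d0 := dpos.
move=> t; have cm : {for t, continuous (fun t : R => Num.max 0 t)}.
  by apply: continuous_max; [exact: cvg_cst|exact: cvg_id].
apply: cvgM.
  by apply: cvgM => //; apply: cvgD => //; exact: cvg_cst.
apply: cvgV.
  by rewrite expf_neq0// gt_eqF// ltr_wpDl// le_max lexx.
by apply: cvgM; apply: cvgD => //; exact: cvg_cst.
Qed.

Lemma ramp'_bounds t : 0 <= ramp' t <= 1.
Proof.
have d0 := dpos.
rewrite /ramp'; have : 0 <= Num.max 0 t by rewrite le_max lexx.
move: (Num.max 0 t) => m m0.
have md : 0 < (m + d) ^+ 2 by rewrite exprn_gt0//; lra.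
have mm : 0 <= m * (m + 2 * d) by apply: mulr_ge0; lra.
apply/andP; split; first by apply: divr_ge0 => //; exact: ltW.
by rewrite ler_pdivrMr// mul1r; have := sqr_ge0 d; nra.
Qed.

Lemma ramp_eq0 t : t <= 0 -> ramp t = 0 /\ ramp' t = 0.
Proof.
have d0 := dpos. by move=> t0; rewrite /ramp /ramp' ltNge t0/= max_l// !mul0r. Qed.

Lemma ramp_bounds t : 0 <= t -> t - d <= ramp t <= t.
Proof.
have d0 := dpos.
move=> t0; rewrite /ramp; case: ifPn => [tp|]; last by rewrite -leNgt => ?; lra.
have td : 0 < t + d by lra.
rewrite ler_pdivlMr// ler_pdivrMr//; have := sqr_ge0 d; nra.
Qed.

(** Composition with this odd C^1 contraction makes the support of a function
    vanishing on the boundary compact, at the price of an error [2 d]. *)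
Definition trunc (s : R) : R := ramp (1 * s + - d) - ramp (-1 * s + - d).

Definition trunc' (s : R) : R := ramp' (1 * s + - d) + ramp' (-1 * s + - d).

Lemma is_derive_trunc (s : R) : is_derive s 1 trunc (trunc' s).
Proof.
have h := is_derive_fB (is_derive_fcomp (is_derive_faff 1 (- d) s) (is_derive_ramp _))
  (is_derive_fcomp (is_derive_faff (-1) (- d) s) (is_derive_ramp _)).
by apply: (is_derive_ext h) => //; rewrite /trunc'; ring.
Qed.

Lemma continuous_trunc' : continuous trunc'.
Proof.
move=> s; apply: cvgD.
  apply: (@continuous_comp _ _ _ (fun s : R => 1 * s + - d) ramp').
    exact: is_derive_continuous (is_derive_faff _ _ _).
  exact: continuous_ramp'.
apply: (@continuous_comp _ _ _ (fun s : R => -1 * s + - d) ramp').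
  exact: is_derive_continuous (is_derive_faff _ _ _).
exact: continuous_ramp'.
Qed.

Lemma trunc'_bounds s : 0 <= trunc' s <= 1.
Proof.
have d0 := dpos.
rewrite /trunc'; have := ramp'_bounds (1 * s + - d); have := ramp'_bounds (-1 * s + - d).
have [s0|s0] := leP 0 s.
  by have [_ ->] := @ramp_eq0 (-1 * s + - d) ltac:(lra); lra.
by have [_ ->] := @ramp_eq0 (1 * s + - d) ltac:(lra); lra.
Qed.

Lemma trunc_eq0 s : `|s| <= d -> trunc s = 0 /\ trunc' s = 0.
Proof.
have d0 := dpos.
rewrite ler_norml => sd; rewrite /trunc /trunc'.
have [-> ->] := @ramp_eq0 (1 * s + - d) ltac:(lra).
by have [-> ->] := @ramp_eq0 (-1 * s + - d) ltac:(lra); rewrite subrr addr0.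
Qed.

Lemma trunc_close s : `|trunc s - s| <= 2 * d.
Proof.
have d0 := dpos.
have [sd|sd] := leP `|s| d.
  by rewrite (trunc_eq0 sd).1 sub0r normrN; lra.
rewrite /trunc; have [s0|s0] := leP 0 s.
  have [-> _] := @ramp_eq0 (-1 * s + - d) ltac:(lra).
  rewrite ger0_norm// in sd.
  by have := @ramp_bounds (1 * s + - d) ltac:(lra); rewrite ler_norml; lra.
have [-> _] := @ramp_eq0 (1 * s + - d) ltac:(lra).
rewrite ltr0_norm// in sd.
by have := @ramp_bounds (-1 * s + - d) ltac:(lra); rewrite ler_norml; lra.
Qed.

End Truncation.

Section Gluing.
Context {R : realType}.
Variables (A : set (R * R)) (h h1 : R * R -> R).
Hypothesis oA : open A.
Hypothesis h0 : forall p, ~ A p -> \forall q \near p, A q -> h q = 0.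

Let near_eq p : A p -> \forall q \near p, h q = (h \_ A) q.
Proof.
move=> Ap; have : \forall q \near p, A q by exact: open_nbhs_nbhs.
by apply: filterS => q Aq; rewrite patchT// inE.
Qed.

Let near_eq0 p : ~ A p -> \forall q \near p, 0 = (h \_ A) q.
Proof.
move=> /h0; apply: filterS => q hq; rewrite patchE.
by case: ifPn => // /set_mem /hq ->.
Qed.

Lemma continuous_glue : (forall p, A p -> {for p, continuous h}) ->
  forall p, {for p, continuous (h \_ A)}.
Proof.
move=> ch p; have [Ap|nA] := pselect (A p).
  have E := near_eq Ap; change ((h \_ A) @ p --> (h \_ A) p).
  rewrite -(nbhs_singleton E); exact: cvg_trans (near_eq_cvg E) (ch p Ap).
have E := near_eq0 nA; change ((h \_ A) @ p --> (h \_ A) p).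
rewrite -(nbhs_singleton E); exact: cvg_trans (near_eq_cvg E) (cvg_cst _).
Qed.

Lemma is_derive_glue1 :
  (forall p : R * R, A p -> is_derive p.1 1 (fun t => h (t, p.2)) (h1 p)) ->
  forall p : R * R, is_derive p.1 1 (fun t => (h \_ A) (t, p.2)) ((h1 \_ A) p).
Proof.
move=> dh p; have [Ap|nA] := pselect (A p).
  rewrite patchT ?inE//; apply: is_derive_near (dh p Ap).
  exact: near_xslice (near_eq Ap).
rewrite patchC ?inE//; apply: is_derive_near (is_derive_fcst 0 p.1).
exact: near_xslice (near_eq0 nA).
Qed.

Lemma is_derive_glue2 :
  (forall p : R * R, A p -> is_derive p.2 1 (fun t => h (p.1, t)) (h1 p)) ->
  forall p : R * R, is_derive p.2 1 (fun t => (h \_ A) (p.1, t)) ((h1 \_ A) p).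
Proof.
move=> dh p; have [Ap|nA] := pselect (A p).
  rewrite patchT ?inE//; apply: is_derive_near (dh p Ap).
  exact: near_yslice (near_eq Ap).
rewrite patchC ?inE//; apply: is_derive_near (is_derive_fcst 0 p.2).
exact: near_yslice (near_eq0 nA).
Qed.

End Gluing.

Section Energy.
Context {R : realType}.
Variables (D A K : set (R * R)) (uc phi phi1 phi2 g1 g2 : R * R -> R) (d : R).
Hypotheses (d0 : 0 < d) (oD : open D) (Dsquare : D `<=` unit_square).
Hypotheses (oA : open A) (AD : A `<=` D).
Hypothesis solu : classical_solution A uc.
Hypotheses (Cphi : C1 phi phi1 phi2) (KA : K `<=` A).
Hypothesis phi0 : forall p, ~ K p -> phi p = 0.
Hypotheses (mg1 : measurable2 D g1) (mg2 : measurable2 D g2).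
Hypotheses (ig1 : integrable2 D (fun p => g1 p ^+ 2)).
Hypotheses (ig2 : integrable2 D (fun p => g2 p ^+ 2)).
Hypothesis weak : forall psi, test_function D psi ->
  (\int[leb2]_(p in (D : set plane)) (g1 p * dx psi p + g2 p * dy psi p)%:E =
   \int[leb2]_(p in (D : set plane)) (psi p)%:E)%E.

Let uh : R * R -> R := uc \_ A.
Let z p := uh p - phi p.
Let S := [set p | d <= `|z p|].
Let w p := trunc d (z p).
Let w1 := (fun p => trunc' d (z p) * (dx uc p - phi1 p)) \_ A.
Let w2 := (fun p => trunc' d (z p) * (dy uc p - phi2 p)) \_ A.

Let mD : measurable (D : set (@plane R)).
Proof. exact: measurable_open_plane. Qed.

Let fD : (leb2 (D : set (@plane R)) < +oo)%E.
Proof. exact: leb2_unit_square_subset. Qed.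

Let cuh p : {for p, continuous uh}.
Proof. exact: zero_ext_continuous. Qed.

Let cz p : {for p, continuous z}.
Proof. by have [cphi _ _ _ _] := Cphi; apply: cvgB; [exact: cuh|exact: cphi]. Qed.

Let z_out p : ~ A p -> z p = 0.
Proof.
by move=> nA; rewrite /z /uh zero_ext_out// phi0 ?subrr// => /KA.
Qed.

Let z_in p : A p -> z p = uc p - phi p.
Proof. by move=> Ap; rewrite /z /uh zero_ext_in. Qed.

Let SA : S `<=` A.
Proof.
move=> p; rewrite /S/= => dz; apply: contrapT => nA.
by move: dz; rewrite z_out// normr0 leNgt d0.
Qed.

Let cS : compact S.
Proof.
apply: (subclosed_compact _ (@compact_rectangle R (-1) 1 (-1) 1)).
  have -> : S = (fun p => `|z p|) @^-1` [set x | d <= x] by [].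
  apply: preimage_closed; last exact: closed_ge.
  by move=> p _; apply: continuous_comp; [exact: cz|exact: norm_continuous].
by move=> p /SA/AD/Dsquare.
Qed.

Let trunc_out p : ~ S p -> trunc d (z p) = 0 /\ trunc' d (z p) = 0.
Proof.
by rewrite /S/= => /negP; rewrite -ltNge => zd; apply: trunc_eq0 => //; exact: ltW.
Qed.

Let near_out p : ~ A p -> \forall q \near p, ~ S q.
Proof. by move=> nA; apply: near_notin_compact => // /SA. Qed.

Let wE : w = w \_ A.
Proof.
apply/funext => p; rewrite patchE; case: ifPn => //; rewrite notin_setE => nA.
by rewrite /w (trunc_out _).1// => /SA.
Qed.

Let Cw : C1 w w1 w2.
Proof.
have [cphi cphi1 cphi2 dphi1 dphi2] := Cphi.
have [[cu [dux duy [cdx _] [cdy _]]] _ _ _] := solu.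
have ct p : {for p, continuous (fun p => trunc' d (z p))}.
  by apply: (@continuous_comp _ _ _ z (trunc' d)); [exact: cz|exact: continuous_trunc'].
split.
- move=> p; apply: (@continuous_comp _ _ _ z (trunc d)); first exact: cz.
  exact: is_derive_continuous (is_derive_trunc _ _).
- apply: continuous_glue => // p Ap.
    by apply: filterS (near_out Ap) => q nS _; rewrite (trunc_out nS).2 mul0r.
  by apply: cvgM; [exact: ct|apply: cvgB; [exact: cdx|exact: cphi1]].
- apply: continuous_glue => // p Ap.
    by apply: filterS (near_out Ap) => q nS _; rewrite (trunc_out nS).2 mul0r.
  by apply: cvgM; [exact: ct|apply: cvgB; [exact: cdy|exact: cphi2]].
- rewrite wE; apply: is_derive_glue1 => // p Ap.
    by apply: filterS (near_out Ap) => q nS _; rewrite /w (trunc_out nS).1.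
  have nA : \forall q \near p, A q by exact: open_nbhs_nbhs.
  apply: (@is_derive_near _ (fun t => trunc d (uc (t, p.2) - phi (t, p.2)))).
    by apply: filterS (near_xslice nA) => t At; rewrite /w z_in.
  rewrite z_in//; case: p Ap {nA} => x y Ap.
  exact: (is_derive_fcomp (is_derive_fB (derivable_is_derive (dux _ Ap)) (dphi1 (x, y)))
    (is_derive_trunc d0 _)).
- rewrite wE; apply: is_derive_glue2 => // p Ap.
    by apply: filterS (near_out Ap) => q nS _; rewrite /w (trunc_out nS).1.
  have nA : \forall q \near p, A q by exact: open_nbhs_nbhs.
  apply: (@is_derive_near _ (fun t => trunc d (uc (p.1, t) - phi (p.1, t)))).
    by apply: filterS (near_yslice nA) => t At; rewrite /w z_in.
  rewrite z_in//; case: p Ap {nA} => x y Ap.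
  exact: (is_derive_fcomp (is_derive_fB (derivable_is_derive (duy _ Ap)) (dphi2 (x, y)))
    (is_derive_trunc d0 _)).
Qed.

Let w_out p : ~ S p -> w p = 0.
Proof. by move=> /trunc_out[]. Qed.

Let SD : S `<=` D.
Proof. by move=> p /SA/AD. Qed.

Let weak_w : integral2 D (fun p => g1 p * w1 p + g2 p * w2 p - w p) = 0.
Proof. exact: (weak_equation_C1 oD Dsquare cS SD Cw w_out). Qed.

Let weak_w_integrable : integrable2 D (fun p => g1 p * w1 p + g2 p * w2 p - w p).
Proof. exact: weak_equation_integrable. Qed.

(* The classical equation tested against [w]: the divergence of [w grad u]
   integrates to zero. *)
Let E1 : R * R -> R := (fun p => dx uc p * w1 p + dy uc p * w2 p - w p) \_ A.

Let classical_w : integrable2 D E1 /\ integral2 D E1 = 0.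
Proof.
have [cw cw1 cw2 dw1 dw2] := Cw.
have [[cu [dux duy [cdx [dxx _ cdxx _]] [cdy [_ dyy _ cdyy]]]] _ eqn _] := solu.
pose X1 p := dx (dx uc) p * w p + dx uc p * w1 p.
pose X2 p := dy (dy uc) p * w p + dy uc p * w2 p.
have out1 q : ~ S q -> w1 q = 0.
  move=> nS; rewrite /w1 patchE; case: ifPn => // _.
  by rewrite (trunc_out nS).2 mul0r.
have out2 q : ~ S q -> w2 q = 0.
  move=> nS; rewrite /w2 patchE; case: ifPn => // _.
  by rewrite (trunc_out nS).2 mul0r.
have sq (h : R * R -> R) p : ~ unit_square p -> (h \_ A) p = 0.
  by move=> np; rewrite patchC// inE => /AD/Dsquare.
have zD (h : R * R -> R) p : ~ D p -> (h \_ A) p = 0.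
  by move=> np; rewrite patchC// inE => /AD.
have [i1 I1] : integrable2 D (X1 \_ A) /\ integral2 D (X1 \_ A) = 0.
  apply: (@integral_partial1 _ ((fun p => dx uc p * w p) \_ A)) => //.
  - apply: is_derive_glue1 => // p Ap.
      by apply: filterS (near_out Ap) => q nS _; rewrite w_out// mulr0.
    case: p Ap => x y Ap.
    exact: (is_derive_fM (derivable_is_derive (dxx _ Ap)) (dw1 (x, y))).
  - apply: continuous_glue => // p Ap.
      by apply: filterS (near_out Ap) => q nS _; rewrite /X1 w_out// out1// !mulr0 addr0.
    apply: cvgD; apply: cvgM; [exact: (cdxx.1 p Ap)|exact: cw|exact: cdx|exact: cw1].
  - by move=> p; exact: sq.
  - by move=> p; exact: zD.
have [i2 I2] : integrable2 D (X2 \_ A) /\ integral2 D (X2 \_ A) = 0.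
  apply: (@integral_partial2 _ ((fun p => dy uc p * w p) \_ A)) => //.
  - apply: is_derive_glue2 => // p Ap.
      by apply: filterS (near_out Ap) => q nS _; rewrite w_out// mulr0.
    case: p Ap => x y Ap.
    exact: (is_derive_fM (derivable_is_derive (dyy _ Ap)) (dw2 (x, y))).
  - apply: continuous_glue => // p Ap.
      by apply: filterS (near_out Ap) => q nS _; rewrite /X2 w_out// out2// !mulr0 addr0.
    apply: cvgD; apply: cvgM; [exact: (cdyy.1 p Ap)|exact: cw|exact: cdy|exact: cw2].
  - by move=> p; exact: sq.
  - by move=> p; exact: zD.
have E p : D p -> (X1 \_ A) p + (X2 \_ A) p = E1 p.
  move=> _; have [Ap|nA] := pselect (A p); last by rewrite /E1 !patchC ?inE// addr0.
  rewrite /E1 !patchT ?inE// /X1 /X2.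
  have := eqn p Ap; rewrite /laplacian => h.
  have -> : dy (dy uc) p = -1 - dx (dx uc) p by rewrite -h; ring.
  by ring.
split.
  by apply: (eq_integrable2 mD E); exact: integrable2D.
by rewrite -(eq_integral2 E) integral2D// I1 I2 addr0.
Qed.

(** Poincare's inequality in disguise: [w^2 + 2 x w w1] is the x-derivative of
    [x w^2]. *)
Let V p := w p ^+ 2 + 2 * p.1 * w p * w1 p.

Let poincare : integrable2 D V /\ integral2 D V = 0.
Proof.
have [cw cw1 _ dw1 _] := Cw.
apply: (@integral_partial1 _ (fun p => p.1 * (w p * w p))) => //.
- move=> [x y].
  apply: (is_derive_ext (is_derive_fM (is_derive_fid x)
    (is_derive_fM (dw1 (x, y)) (dw1 (x, y))))) => //.
  by rewrite /V/=; ring.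
- move=> p; have c1 := @continuous_fst R p.
  apply: cvgD; first exact: cvgM (cw p) (cw p).
  by apply: cvgM; [apply: cvgM; [apply: cvgM; [exact: cvg_cst|]|]|]; [exact: c1|exact: cw|exact: cw1].
- by move=> p np; rewrite w_out ?mulr0// => /SD/Dsquare.
- by move=> p np; rewrite /V w_out ?expr0n/= ?mulr0 ?mul0r ?addr0// => /SD.
Qed.

(** Testing both equations with [w] and subtracting, the gradient of [u] drops
    out: only the distance from [grad phi] to the weak gradient remains. *)
Lemma truncated_energy_estimate :
  integrable2 D (fun p => w p ^+ 2) /\
  integral2 D (fun p => w p ^+ 2) <=
    4 * (integral2 D (fun p => (phi1 p - g1 p) ^+ 2) +
         integral2 D (fun p => (phi2 p - g2 p) ^+ 2)).
Proof.
have [cphi cphi1 cphi2 dphi1 dphi2] := Cphi.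
have [cw cw1 cw2 dw1 dw2] := Cw.
have [iE IE] := classical_w; have [iV IV] := poincare.
pose E2 p := g1 p * w1 p + g2 p * w2 p - w p.
have idiff g (f : R * R -> R) : measurable2 D g -> integrable2 D (fun p => g p ^+ 2) ->
    (forall p, {for p, continuous f}) -> integrable2 D (fun p => (f p - g p) ^+ 2).
  move=> mg ig cf.
  have i1 : integrable2 D (fun p => f p ^+ 2).
    by apply: continuous_integrable2 => // p; rewrite /=; exact: cvgM (cf p) (cf p).
  have i2 : integrable2 D (fun p => g p * (-2 * f p)).
    apply: L2_mul_continuous_integrable2 => // p.
    by apply: cvgM; [exact: cvg_cst|exact: cf].
  have := integrable2D mD (integrable2D mD i1 i2) ig.
  by apply: eq_integrable2 => // p _; ring.
have j1 := idiff _ _ mg1 ig1 cphi1; have j2 := idiff _ _ mg2 ig2 cphi2.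
have iw : integrable2 D (fun p => w p ^+ 2).
  by apply: continuous_integrable2 => // p; exact: cvgM (cw p) (cw p).
split => //.
pose B p := 2 * V p + 8 * (E1 p - E2 p) +
  4 * ((phi1 p - g1 p) ^+ 2 + (phi2 p - g2 p) ^+ 2).
have iE2 : integrable2 D (fun p => E1 p - E2 p) by exact: integrable2B.
have i12 : integrable2 D (fun p => 2 * V p + 8 * (E1 p - E2 p)).
  by apply: integrable2D => //; exact: integrable2Z.
have jj : integrable2 D (fun p => (phi1 p - g1 p) ^+ 2 + (phi2 p - g2 p) ^+ 2) by exact: integrable2D.
have IB : integral2 D B = 4 * (integral2 D (fun p => (phi1 p - g1 p) ^+ 2) +
         integral2 D (fun p => (phi2 p - g2 p) ^+ 2)).
  rewrite /B integral2D//; last exact: integrable2Z.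
  rewrite integral2D//; [|exact: integrable2Z|exact: integrable2Z].
  rewrite !integral2Z// integral2B// IV IE weak_w (integral2D mD j1 j2); ring.
rewrite -IB; apply: le_integral2 => //.
  by apply: integrable2D => //; exact: integrable2Z.
move=> p Dp; rewrite /B /V /E1 /E2.
have [p1 _] : -1 <= p.1 <= 1 /\ -1 <= p.2 <= 1 by apply/rectangleP; exact: Dsquare.
have [Ap|nA] := pselect (A p); last first.
  rewrite /w1 /w2 !(zero_ext_out _ nA).
  have -> : w p = 0 by apply: w_out => /SA.
  by have := sqr_ge0 (phi1 p - g1 p); have := sqr_ge0 (phi2 p - g2 p); lra.
rewrite patchT ?inE// /w1 /w2 !patchT ?inE//.
have /andP[t0 t1] := trunc'_bounds d0 (z p).
(* The difference of the two sides is a sum of squares with coefficients that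
   are nonnegative because [0 <= t <= 1] and [|x| <= 1]. *)
have alg (W x t a b ux uy f1 f2 h1 h2 : R) : -1 <= x <= 1 -> 0 <= t -> t <= 1 ->
    a = ux - f1 -> b = uy - f2 ->
    W ^+ 2 <= 2 * (W ^+ 2 + 2 * x * W * (t * a)) +
      8 * (ux * (t * a) + uy * (t * b) - W - (h1 * (t * a) + h2 * (t * b) - W)) +
      4 * ((f1 - h1) ^+ 2 + (f2 - h2) ^+ 2).
  move=> x1 t0' t1' aE bE.
  have -> : ux = a + f1 by rewrite aE; ring.
  have -> : uy = b + f2 by rewrite bE; ring.
  have s1 : 0 <= (W + 2 * x * (t * a)) ^+ 2 by exact: sqr_ge0.
  have s2 : 0 <= (t * a) ^+ 2 * (1 - x ^+ 2) by rewrite mulr_ge0 ?sqr_ge0//; nra.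
  have s3 : 0 <= (t * a + (f1 - h1)) ^+ 2 by exact: sqr_ge0.
  have s4 : 0 <= (t * b + (f2 - h2)) ^+ 2 by exact: sqr_ge0.
  have tt : 0 <= t * (1 - t) by rewrite mulr_ge0//; lra.
  have s5 : 0 <= t * (1 - t) * a ^+ 2 by rewrite mulr_ge0 ?sqr_ge0.
  have s6 : 0 <= t * (1 - t) * b ^+ 2 by rewrite mulr_ge0 ?sqr_ge0.
  have s7 : 0 <= (t * b) ^+ 2 by exact: sqr_ge0.
  rewrite -subr_ge0 (_ : _ - _ = (W + 2 * x * (t * a)) ^+ 2 +
    4 * ((t * a) ^+ 2 * (1 - x ^+ 2)) + 4 * (t * b) ^+ 2 +
    4 * (t * a + (f1 - h1)) ^+ 2 + 4 * (t * b + (f2 - h2)) ^+ 2 +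
    8 * (t * (1 - t) * a ^+ 2) + 8 * (t * (1 - t) * b ^+ 2)); last by ring.
  lra.
by apply: alg.
Qed.

End Energy.

(** * Convergence of the solutions under exhaustion of the domain *)

(** Of the gap [6 k], the two oscillations absorb [2 k] and the truncation error
    another [2 k]; the remaining [2 k] is shared by [W] and [f - a]. *)
Lemma discrepancy_split (R : realType) (k U U0 W f a a0 : R) :
  `|U - U0| <= k -> `|a - a0| < k -> 6 * k <= `|U0 - a0| ->
  `|W - (U - f)| <= 2 * k -> 2 * k ^+ 2 <= W ^+ 2 + (f - a) ^+ 2.
Proof.
move=> hU ha far hW.
have n5 (x1 x2 x3 x4 x5 : R) : `|- x1 + (- x2 + (x3 + (x4 + x5)))| <=
    `|x1| + (`|x2| + (`|x3| + (`|x4| + `|x5|))).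
  rewrite -(normrN x1) -(normrN x2).
  do 3 (apply: (le_trans (ler_normD _ _)); rewrite lerD2l).
  exact: ler_normD.
have k0 : 0 <= k by apply: le_trans hU.
have big : 2 * k <= `|W| + `|f - a|.
  have := n5 (U - U0) (W - (U - f)) W (f - a) (a - a0).
  have -> : - (U - U0) + (- (W - (U - f)) + (W + ((f - a) + (a - a0)))) = U0 - a0.
    by ring.
  lra.
rewrite -(real_normK (num_real W)) -(real_normK (num_real (f - a))).
move: (`|W|) (`|f - a|) big => x y big.
by have := sqr_ge0 (x - y); nra.
Qed.

Section Convergence.
Context {R : realType}.
Variables (D : set (R * R)) (Om : R -> set (R * R)) (e0 : R).
Variables (ua : R * R -> R) (ue : R -> R * R -> R).
Hypothesis e0_gt0 : 0 < e0.
Hypothesis oOm : forall e : R, 0 < e < e0 -> open (Om e).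
Hypothesis nested : forall e f : R, 0 < e -> e < f -> f < e0 -> Om f `<=` Om e.
Hypothesis exhaust : \bigcup_(e in [set e | 0 < e < e0]) Om e = D.
Hypothesis Ddisk : D `<=` disk.
Hypothesis weakD : weak_solution D ua.
Hypothesis solu : forall e : R, 0 < e < e0 -> classical_solution (Om e) (ue e).

Let oD : open D.
Proof. by rewrite -exhaust; apply: bigcup_open => e; exact: oOm. Qed.

Let mD : measurable (D : set (@plane R)).
Proof. exact: measurable_open_plane. Qed.

Let Dsquare : D `<=` unit_square.
Proof.
by move=> p /Ddisk/disk_bounds[? ?]; apply/rectangleP; split; lra.
Qed.

Let fD : (leb2 (D : set (@plane R)) < +oo)%E.
Proof. exact: leb2_unit_square_subset. Qed.

Let OmD e : 0 < e < e0 -> Om e `<=` D.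
Proof. by move=> ee p Op; rewrite -exhaust; exists e. Qed.

(** Supports of test functions of [D] are compact, hence the approximants of the
    weak solution are eventually admissible in the smaller domains. *)
Lemma compact_eventually_inside (K : set (R * R)) : compact K -> K `<=` D ->
  exists2 e1, 0 < e1 <= e0 & forall e, 0 < e < e1 -> K `<=` Om e.
Proof.
move=> cK KD.
pose good B := exists2 e1, 0 < e1 <= e0 & forall e, 0 < e < e1 -> B `<=` Om e.
have [||p Kp|B [e1 e10 BO] KB] := @compact_induction _ good K cK.
- by exists e0 => [|e _ p []]; rewrite lexx andbT.
- move=> A B [e1 e10 AO] [e2 e20 BO]; exists (Num.min e1 e2).
    by rewrite lt_min ge_min; lra.
  by move=> e; rewrite lt_min => ee p [Ap|Bp]; [apply: AO|apply: BO] => //; lra.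
- have := KD p Kp; rewrite -exhaust => -[f /= f0 Op].
  exists (Om f); first exact: (open_nbhs_nbhs (conj (oOm f0) Op)).
  exists f => [|e ee]; first by lra.
  by apply: nested; lra.
by exists e1 => // e ee p Kp; exact: (BO e ee p (KB p Kp)).
Qed.

Let L2_data g : in_L2 D g -> measurable2 D g /\ integrable2 D (fun p => g p ^+ 2).
Proof. by move=> [mg Lg]; split => //; exact: L2_integrable2. Qed.

Let small_L2 (h : R * R -> R) (c : R) : measurable2 D h -> (L2_sq D h < c%:E)%E ->
  integrable2 D (fun p => h p ^+ 2) /\ integral2 D (fun p => h p ^+ 2) < c.
Proof.
move=> mh Lc; have i := L2_integrable2 mh (lt_trans Lc (ltry c)).
split => //; rewrite -lte_fin -L2_integral2//.
rewrite ge0_fin_numE; first exact: lt_trans Lc (ltry c).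
by apply: integral_ge0 => p _; rewrite lee_fin sqr_ge0.
Qed.

Let test_C1 phi : test_function D phi -> C1 phi (dx phi) (dy phi).
Proof.
move=> [sm _]; have [cphi [d1 d2 [c1 _] [c2 _]]] := sm 1%N.
split.
- by move=> p; exact: cphi.
- by move=> p; exact: c1.
- by move=> p; exact: c2.
- by move=> p; exact: derivable_is_derive (d1 p I).
- by move=> p; exact: derivable_is_derive (d2 p I).
Qed.

(** The energy estimate gives L^2 closeness of the two solutions; both are
    equicontinuous near [p] (the classical ones by the barrier estimate,
    uniformly in the domain), so L^2 closeness forces closeness at [p]. *)
Theorem solutions_converge p (eta : R) : D p -> 0 < eta ->
  exists2 e1, 0 < e1 <= e0 & forall e, 0 < e < e1 ->
    Om e p /\ `|ue e p - ua p| < eta.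
Proof.
move=> Dp eta0.
have [cua [g1 [g2 [[Lu Lg1 Lg2 [phi [tphi cvu cvx cvy]]] weak]]]] := weakD.
have [mu iu] := L2_data Lu; have [mg1 ig1] := L2_data Lg1; have [mg2 ig2] := L2_data Lg2.
pose k := eta / 6; have k0 : 0 < k by rewrite /k; lra.
have k6 : 6 * k = eta by rewrite /k; field.
(* a square around [p] inside all the small-parameter domains *)
have := Dp; rewrite -exhaust => -[f /= f0 Ofp].
have [d d0 dO] := open_rectangle (oOm f0) Ofp.
pose r := d / 2; have r0 : 0 < r by rewrite /r; lra.
(* its concentric part on which all oscillations are below [k] *)
have [s1 s10 Hs1] := continuous2_ball (cua p Dp) k0.
pose s := Num.min (s1 / 2) (Num.min (k * r) r).
have kr0 : 0 < k * r by rewrite mulr_gt0.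
have s0 : 0 < s by rewrite /s !lt_min kr0 r0 andbT; lra.
have [ss1 skr sr] : [/\ s <= s1 / 2, s <= k * r & s <= r].
  by rewrite /s !ge_min !lexx !orbT.
have sd : s <= d by rewrite (le_trans sr)// /r; lra.
have rd : 2 * r = d by rewrite /r; lra.
have slt : s < s1 by rewrite (le_lt_trans ss1)//; lra.
pose Q := rectangle (p.1 - s) (p.1 + s) (p.2 - s) (p.2 + s).
have mQ : measurable (Q : set (@plane R)) by exact: measurable_rectangle.
(* The L^2 errors add up to at most [9 c], below the mass [8 k^2 s^2] that a
   discrepancy of [6 k] at [p] would produce on [Q]. *)
pose c := k ^+ 2 * s ^+ 2 / 2.
have c0 : 0 < c by rewrite /c divr_gt0// mulr_gt0// exprn_gt0.
have c0' : (0 < c%:E)%E by rewrite lte_fin.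
have [n [hu hx hy]] : exists n, [/\ (L2_sq D (fun p => (phi n p - ua p)%R) < c%:E)%E,
    (L2_sq D (fun p => (dx (phi n) p - g1 p)%R) < c%:E)%E &
    (L2_sq D (fun p => (dy (phi n) p - g2 p)%R) < c%:E)%E].
  have lt_c (X : nat -> \bar R) : X n @[n --> \oo] --> 0%E -> \forall n \near \oo, (X n < c%:E)%E.
    by move=> X0; exact: X0 _ (open_ereal_lt' c0').
  have [n _ /(_ n (leqnn n)) [[? ?] ?]] := filterI (filterI (lt_c _ cvu) (lt_c _ cvx)) (lt_c _ cvy).
  by exists n.
have [_ [K [cK KD K0]]] := tphi n.
have Cphi := test_C1 (tphi n).
have [cphi cphi1 cphi2 _ _] := Cphi.
have [e1 e10 KO] := compact_eventually_inside cK KD.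
exists (Num.min e1 f); first by rewrite lt_min ge_min; lra.
move=> e; rewrite lt_min => /and3P[ep ee1 ef].
have /andP[_ fe0] := f0.
have e0e : 0 < e < e0 by rewrite ep (lt_trans ef fe0).
have fe : Om f `<=` Om e := nested ep ef fe0.
split; first exact: fe.
rewrite ltNge; apply/negP => far.
have solue := solu e0e; have oe := oOm e0e.
have eD := OmD e0e.
have edisk : Om e `<=` disk by move=> q /eD/Ddisk.
have Ke : K `<=` Om e by apply: KO; rewrite ep.
pose w q := trunc k ((ue e \_ (Om e)) q - phi n q).
have [iw Iw] : integrable2 D (fun q => w q ^+ 2) /\
    integral2 D (fun q => w q ^+ 2) <=
      4 * (integral2 D (fun q => (dx (phi n) q - g1 q) ^+ 2) +
           integral2 D (fun q => (dy (phi n) q - g2 q) ^+ 2)).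
  exact: (truncated_energy_estimate k0 oD Dsquare oe eD solue Cphi Ke K0
    mg1 mg2 ig1 ig2 weak).
have mcont h : (forall q, {for q, continuous h}) -> measurable2 D h.
  by move=> ch; exact: continuous_measurable2.
have [iu' Iu] := small_L2 (measurable_funB (mcont _ cphi) mu) hu.
have [_ Ix] := small_L2 (measurable_funB (mcont _ cphi1) mg1) hx.
have [_ Iy] := small_L2 (measurable_funB (mcont _ cphi2) mg2) hy.
have QO : Q `<=` Om e.
  move=> q /rectangle_radiusP[q1 q2]; apply/fe/dO/rectangle_radiusP.
  by rewrite !(le_trans _ sd).
have onQ q : Q q -> 2 * k ^+ 2 <= w q ^+ 2 + (phi n q - ua q) ^+ 2.
  move=> Qq; have /rectangle_radiusP[q1 q2] := Qq.
  have osc_e : `|(ue e \_ (Om e)) q - (ue e \_ (Om e)) p| <= k.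
    apply: (@le_trans _ _ (s / r)); last by rewrite ler_pdivrMr.
    apply: torsion_osc => // q'; rewrite rd => /dO/fe Oq'; split.
    - exact: zero_ext_continuous.
    - by rewrite (zero_ext_ge0 oe edisk solue) (zero_ext_le oe edisk solue).
    - exact: zero_ext_laplacian.
  have osc_a : `|ua q - ua p| < k.
    by apply: Hs1; [exact: le_lt_trans q1 slt|exact: le_lt_trans q2 slt].
  have farp : 6 * k <= `|(ue e \_ (Om e)) p - ua p|.
    by rewrite (zero_ext_in _ (fe _ Ofp)) k6.
  exact: (discrepancy_split osc_e osc_a farp (trunc_close k0 _)).
have iQ : integrable2 D (\1_Q : R * R -> R).
  apply: (bounded_integrable2 mD fD (M := 1)); first exact: measurable_indic.
  by move=> q _; rewrite indicE; case: (q \in Q); rewrite /= ?normr1 ?normr0.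
have IQ : integral2 D (\1_Q : R * R -> R) = (2 * s) ^+ 2.
  rewrite /integral2 /Rintegral integral_indic// setIidl; last by move=> q /QO/eD.
  by rewrite leb2_rectangle ?ltrD2l ?gtrN//=; ring.
have : integral2 D (fun q => 2 * k ^+ 2 * (\1_Q q)) <=
    integral2 D (fun q => w q ^+ 2 + (phi n q - ua q) ^+ 2).
  apply: le_integral2 => //; [exact: integrable2Z|exact: integrable2D|].
  move=> q _; rewrite indicE; have [/set_mem Qq|nQ] := boolP (q \in Q).
    by rewrite mulr1; exact: onQ.
  by rewrite mulr0 addr_ge0 ?sqr_ge0.
rewrite integral2Z// IQ integral2D//.
have : 9 * c < 2 * k ^+ 2 * (2 * s) ^+ 2.
  rewrite (_ : 2 * k ^+ 2 * (2 * s) ^+ 2 = 16 * c); last by rewrite /c; field.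
  by rewrite ltr_pM2r// ltr_nat.
have contra (W U X Y m M : R) : W <= 4 * (X + Y) -> U < m -> X < m -> Y < m ->
  9 * m < M -> M <= W + U -> False by lra.
exact: contra Iw Iu Ix Iy.
Qed.

End Convergence.

(** * Shape of the superlevel set *)

Section Superlevel.
Context {R : realType}.
Implicit Types (L A : set (R * R)) (p q : R * R).

(** The infimum of the empty set is 0, so the hypothesis also says that some
    parameter with [mu <= 0] exists. *)
Lemma below_bstar (u : R -> R * R -> R) (a : R) : 0 < a < bstar u ->
  0 < a < 1 /\ 0 < mu u a.
Proof.
rewrite /bstar; set S := [set _ | _] => /andP[a0 aS].
have lbS : has_lbound S by exists 0 => s [/andP[s0 _] _]; exact: ltW.
have a1 : a < 1.
  have [S0|/set0P[s Ss]] := eqVneq S set0; first by move: aS; rewrite S0 inf0; lra.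
  have [/andP[_ s1] _] := Ss; apply: lt_trans s1; apply: (lt_le_trans aS).
  exact: ge_inf.
have a01 : 0 < a < 1 by rewrite a0.
split => //; rewrite ltNge; apply/negP => m0.
have : inf S <= a by apply: ge_inf => //; split.
lra.
Qed.

Section Split.
Variables (L : set (R * R)) (x1 y1 x2 y2 : R).
Hypothesis axis : forall x, ~ L (x, 0).
Hypotheses (y1p : 0 < y1) (y2n : y2 < 0) (L1 : L (x1, y1)) (L2 : L (x2, y2)).

Let off_axis p : L p -> p.2 != 0.
Proof. by case: p => x y Lp; apply/eqP => /= y0; apply: (axis (x := x)); rewrite -y0. Qed.

Lemma split_not_connected : ~ connected L.
Proof.
move=> /(_ (L `&` [set p | 0 < p.2])) conn.
have : L `&` [set p | 0 < p.2] = L.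
  apply: conn.
  - by exists (x1, y1).
  - exists [set p | 0 < p.2] => //.
    apply: (@open_comp _ _ (fun p : R * R => p.2) [set y | 0 < y]); last exact: open_gt.
    by move=> p _; exact: continuous_snd.
  - exists [set p | 0 <= p.2].
      apply: (@preimage_closed _ _ (fun p : R * R => p.2) [set y | 0 <= y]); last exact: closed_ge.
      by move=> p _; exact: continuous_snd.
    apply/seteqP; split => p [Lp /=] p2; split => //=; first exact: ltW.
    by rewrite lt_def p2 andbT off_axis.
by move/seteqP => [_ /(_ _ L2)[_ /=]]; have := y2n; lra.
Qed.

(** The segment from the centre to the given point of the opposite half-plane
    would cross the axis inside [L]. *)
Lemma split_not_star_shaped : ~ star_shaped L.
Proof.
move=> [p Lp star].
have cross q : L q -> p.2 * q.2 < 0 -> False.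
  move=> Lq pq.
  have n0 : p.2 - q.2 != 0.
    by apply/eqP => /eqP; rewrite subr_eq0 => /eqP e; move: pq; rewrite e; nra.
  have t01 : 0 <= p.2 / (p.2 - q.2) <= 1.
    have [p0|p0] := ltP 0 p.2.
      have q0 : q.2 < 0 by nra.
      by rewrite divr_ge0 ?ler_pdivrMr/=; lra.
    have p0' : p.2 < 0 by rewrite lt_neqAle off_axis.
    have q0 : 0 < q.2 by nra.
    by rewrite -mulrNN -invrN divr_ge0 ?ler_pdivrMr/=; lra.
  have := star q _ Lq t01.
  have -> : p.2 + p.2 / (p.2 - q.2) * (q.2 - p.2) = 0 by field.
  exact: axis.
have [p0|p0] := ltP 0 p.2.
  by apply: (cross _ L2) => /=; have := y2n; nra.
have p0' : p.2 < 0 by rewrite lt_neqAle off_axis.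
by apply: (cross _ L1) => /=; have := y1p; nra.
Qed.

End Split.

(** For [x >= 0], the mirror image across the vertical line at [x / 2] sends the
    point [(x, 0)] to the origin and dominates the solution; the case [x < 0]
    follows by symmetry. *)
Lemma axis_max (A : set (R * R)) (rho : R -> R) (v : R * R -> R) (x : R) :
  open A -> A `<=` disk -> classical_solution A v -> axes_symmetric A ->
  A = [set p | `|p.2| < 1 /\ - rho p.2 < p.1 < rho p.2] ->
  (v \_ A) (x, 0) <= (v \_ A) (0, 0).
Proof.
move=> oA Ad sol symA AE.
have e1 : (1 : R) ^+ 2 = 1 by rewrite expr1n.
have eN1 : (- 1 : R) ^+ 2 = 1 by rewrite sqrrN.
wlog x0 : x / 0 <= x.
  move=> H; have [|xn] := leP 0 x; first exact: H.
  have := H (- x) ltac:(lra).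
  have := zero_ext_symmetric oA Ad sol eN1 e1 _ (x, 0).
  rewrite /= !addr0 !mul1r mulN1r => -> // -[a b] /=.
  by rewrite !addr0 mul1r mulN1r => /symA[].
have := @zero_ext_reflection _ _ _ oA Ad sol (x / 2) (x, 0).
rewrite /= (_ : -1 * x + 2 * (x / 2) = 0); last by field.
rewrite mul1r addr0; apply; last lra.
move=> [a b]; rewrite AE /= mul1r addr0 => -[b1 ar] ap; split => //; lra.
Qed.

End Superlevel.

Theorem corollary1p4 (R : realType)
    (u : R -> R * R -> R)
    (eps0 : R -> R) (rho : R -> R -> R -> R) (Omega : R -> R -> set (R * R))
    (ue : R -> R -> R * R -> R)
    (hu : forall a : R, 0 < a < 1 -> weak_solution (slit_disk a) (u a))
    (hOmega : standing_assumptions eps0 rho Omega)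
    (hue : forall a e : R, 0 < a < 1 -> 0 < e < eps0 a ->
       classical_solution (Omega a e) (ue a e))
    (a : R) (ha : 0 < a < bstar u) :
  exists epsstar : R, 0 < epsstar <= eps0 a /\
    forall e : R, 0 < e < epsstar ->
      [/\ domain (Omega a e) /\ smooth_boundary (Omega a e),
          axes_symmetric (Omega a e),
          star_shaped_wrt (0, 0) (Omega a e),
          x_convex (Omega a e) &
          ~ star_shaped (superlevel (Omega a e) (ue a e)) /\
          ~ connected (superlevel (Omega a e) (ue a e))].
Proof.
have [a01 mu0] := below_bstar ha.
have [e00 [geom [_ [nested exhaust]]]] := hOmega a a01.
have weakD := hu a a01.
have sol e : 0 < e < eps0 a -> classical_solution (Omega a e) (ue a e) by exact: hue.
have oOm e : 0 < e < eps0 a -> open (Omega a e).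
  by move=> /geom[_ [[[]]]].
have Ddisk : slit_disk a `<=` disk by move=> p [].
have axisD y : `|y| < 1 -> slit_disk a (0, y).
  move=> y1; split; last by move=> [/= [|] ? _]; lra.
  by rewrite /disk/= /enorm/= expr0n/= add0r sqrtr_sqr.
have [y y1 gy] : exists2 y : R, `|y| < 1 & u a (0, 0) < u a (0, y).
  have [|y y1 gy] := @convex_at0_not_max R (fun t => u a (0, t)) _ mu0; last by exists y.
  move=> t t1; apply: (@continuous_comp _ _ _ (fun t : R => (0, t)) (u a)).
    exact: (@cvg_yslice R (0, t)).
  by case: weakD => cu _; apply: cu; exact: axisD.
pose eta := (u a (0, y) - u a (0, 0)) / 2.
have eta0 : 0 < eta by rewrite /eta; lra.
(* The strict inequality between two values of the limit passes to the
   approximating solutions. *)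
have conv := solutions_converge e00 oOm nested exhaust Ddisk weakD sol.
have [e1 e10 H1] := conv (0, 0) eta (axisD 0 ltac:(by rewrite normr0)) eta0.
have [e2 e20 H2] := conv (0, y) eta (axisD y y1) eta0.
exists (Num.min e1 e2); split; first by rewrite lt_min ge_min; lra.
move=> e; rewrite lt_min => ee; have e0e : 0 < e < eps0 a by lra.
have [[OE _ _ rho_pos _] [[dom _] smooth _ _ symO] Osub star xconv] := geom e e0e.
split => //.
have oO := oOm e e0e; have solO := sol e e0e.
have Odisk : Omega a e `<=` disk by move=> p /Osub/Ddisk.
have [in0 c0] := H1 e ltac:(lra); have [iny cy] := H2 e ltac:(lra).
have gt_y : ue a e (0, 0) < ue a e (0, y).
  by move: c0 cy; rewrite /eta !ltr_norml; lra.
have Ony : Omega a e (0, - y) by have [] := symO 0 y iny.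
have even_y : ue a e (0, - y) = ue a e (0, y).
  have e1' : (1 : R) ^+ 2 = 1 by rewrite expr1n.
  have eN1 : (- 1 : R) ^+ 2 = 1 by rewrite sqrrN.
  have := zero_ext_symmetric oO Odisk solO e1' eN1 _ (0, y).
  rewrite /= !addr0 mul1r mulN1r !zero_ext_in//; apply => -[x t] /=.
  by rewrite !addr0 mul1r mulN1r => /symO[].
have Ly : superlevel (Omega a e) (ue a e) (0, y) by split.
have Lny : superlevel (Omega a e) (ue a e) (0, - y) by split => //; rewrite even_y.
have axis x : ~ superlevel (Omega a e) (ue a e) (x, 0).
  move=> [Ox]; apply/negP; rewrite -leNgt.
  by have := axis_max x oO Odisk solO symO OE; rewrite !zero_ext_in.
have yn0 : y != 0 by apply/eqP => y0; move: gt_y; rewrite y0 ltxx.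
have [yp|yn] := ltP 0 y.
  by split; [apply: (split_not_star_shaped axis yp _ Ly Lny)|apply: (split_not_connected axis yp _ Ly Lny)]; lra.
have yn' : y < 0 by rewrite lt_neqAle yn0.
have nyp : 0 < - y by lra.
by split; [exact: (split_not_star_shaped axis nyp yn' Lny Ly)|exact: (split_not_connected axis nyp yn' Lny Ly)].
Qed.
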